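(* (Generalized quantum McKay correspondence.) Let $\mathcal{C}$ be a fusion category, let $\mathcal{M}$ be a finite semisimple left module category over $\mathcal{C}$, let $\Pi\in\mathcal{C}$ be an object, and let $m\ge2$ be an integer. The separated McKay quiver of $\mathcal{M}$ with respect to $\Pi$ is a disjoint union of $ADE$ quivers with the same Coxeter number $m$ if and only if $\operatorname{FPdim}(\Pi)=2\cos(\pi/m)<2$.
   Context: $\Bbbk$ is an algebraically closed field; all categories and functors are $\Bbbk$-linear. A fusion category is a semisimple finite abelian rigid monoidal category with simple unit. A left module category over $\mathcal{C}$ is an abelian category $\mathcal{M}$ with an additive monoidal functor $\mathcal{C}\to\operatorname{End}(\mathcal{M})$, written $C\mapsto C\otimes-$; it is finite semisimple if it is a finite abelian category that is semisimple. $\operatorname{Irr}(\mathcal{M})$ is a set of representatives of isomorphism classes of simple objects. The McKay quiver of $\mathcal{M}$ with respect to $\Pi$ is the ordinary quiver with vertex set $\operatorname{Irr}(\mathcal{M})$ and $\dim\operatorname{Hom}_{\mathcal{M}}(\Pi\otimes L,L')$ arrows from $L$ to $L'$. The separated McKay quiver is the bipartite quiver with vertex set $\operatorname{Irr}(\mathcal{M})\times\{\text{left},\text{right}\}$ and, for each arrow $L\to L'$ of the McKay quiver, one arrow from $(L,\text{left})$ to $(L',\text{right})$. An $ADE$ quiver is a quiver whose underlying unoriented graph is a Dynkin diagram of type $A_n$ ($n\geq 1$), $D_n$ ($n\ge4$), $E_6$, $E_7$ or $E_8$; its Coxeter number is that of the corresponding Coxeter group. $\operatorname{FPdim}(\Pi)$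 is the Frobenius--Perron dimension: the Frobenius--Perron eigenvalue of the non-negative matrix of left multiplication by $[\Pi]$ on the Grothendieck ring $[\mathcal{C}]$ in the basis of simple objects.
   Formalization: The module category M is assumed nonzero: for M = 0 the separated McKay quiver is empty, hence an empty disjoint union of ADE quivers for every m, whatever FPdim(Π) is, so the stated equivalence fails. *)

(* Defs.v *)
From mathcomp Require Import all_boot all_order all_algebra.
From mathcomp Require Import boolp classical_sets reals trigo.

Set Implicit Arguments.
Unset Strict Implicit.
Unset Printing Implicit Defensive.

Import Order.TTheory GRing.Theory Num.Theory.
Local Open Scope ring_scope.

Declare Scope lincat_scope.
Delimit Scope lincat_scope with lincat.

(* * Linear categories *)

(* k-linear categories with finite-dimensional Hom spaces: the latter is part
   of being a finite category, so it is built into the type of Hom.  Equality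
   of morphisms is Leibniz equality; objects are only compared up to
   isomorphism. *)
Record linCat (k : fieldType) := LinCat {
  obj :> Type;
  hom : obj -> obj -> vectType k;
  idm : forall a, hom a a;
  comp : forall a b c, hom b c -> hom a b -> hom a c;
  compA : forall a b c d (h : hom c d) (g : hom b c) (f : hom a b),
    comp h (comp g f) = comp (comp h g) f;
  comp1m : forall a b (f : hom a b), comp (idm b) f = f;
  compm1 : forall a b (f : hom a b), comp f (idm a) = f;
  comp_linl : forall a b c (f : hom a b), linear (fun g : hom b c => comp g f);
  comp_linr : forall a b c (g : hom b c), linear (fun f : hom a b => comp g f)
}.
Arguments hom {k} _ _ _, {k _} _ _.
Arguments idm {k _} _.
Arguments comp {k _ a b c} _ _.
Notation "g ∘ f" := (comp g f)
  (at level 40, left associativity) : lincat_scope.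
Local Open Scope lincat_scope.

Definition inverse_pair (k : fieldType) (C : linCat k) (X Y : C)
    (f : hom X Y) (g : hom Y X) : Prop :=
  g ∘ f = idm X /\ f ∘ g = idm Y.

Definition is_iso (k : fieldType) (C : linCat k) (X Y : C) (f : hom X Y) : Prop :=
  exists g : hom Y X, inverse_pair f g.

Definition isomorphic (k : fieldType) (C : linCat k) (X Y : C) : Prop :=
  exists f : hom X Y, is_iso f.

(* * Abelian categories *)

Definition mono (k : fieldType) (C : linCat k) (X Y : C) (f : hom X Y) : Prop :=
  forall (W : C) (g h : hom W X), f ∘ g = f ∘ h -> g = h.

Definition epi (k : fieldType) (C : linCat k) (X Y : C) (f : hom X Y) : Prop :=
  forall (W : C) (g h : hom Y W), g ∘ f = h ∘ f -> g = h.

Definition is_zero (k : fieldType) (C : linCat k) (X : C) : Prop :=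
  (forall (Y : C) (f : hom X Y), f = 0) /\ (forall (Y : C) (f : hom Y X), f = 0).

Definition is_kernel (k : fieldType) (C : linCat k) (K X Y : C)
    (f : hom X Y) (i : hom K X) : Prop :=
  f ∘ i = 0 /\
  forall (W : C) (g : hom W X), f ∘ g = 0 -> exists! h : hom W K, i ∘ h = g.

Definition is_cokernel (k : fieldType) (C : linCat k) (X Y Q : C)
    (f : hom X Y) (p : hom Y Q) : Prop :=
  p ∘ f = 0 /\
  forall (W : C) (g : hom Y W), g ∘ f = 0 -> exists! h : hom Q W, h ∘ p = g.

Definition is_direct_sum (k : fieldType) (C : linCat k) (n : nat)
    (S : 'I_n -> C) (X : C) : Prop :=
  exists (i : forall j, hom (S j) X) (p : forall j, hom X (S j)),
    [/\ forall j, p j ∘ i j = idm (S j),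
        forall j l, j != l -> p j ∘ i l = 0
      & \sum_j i j ∘ p j = idm X].

(* The empty direct sum is a zero object. *)
Definition abelian_cat (k : fieldType) (C : linCat k) : Prop :=
  [/\ forall (n : nat) (S : 'I_n -> C), exists X, is_direct_sum S X,
      forall (X Y : C) (f : hom X Y), exists K (i : hom K X), is_kernel f i,
      forall (X Y : C) (f : hom X Y), exists Q (p : hom Y Q), is_cokernel f p,
      forall (X Y : C) (f : hom X Y), mono f ->
        exists Z (g : hom Y Z), is_kernel g f
    & forall (X Y : C) (f : hom X Y), epi f ->
        exists Z (g : hom Z X), is_cokernel g f].

Definition short_exact (k : fieldType) (C : linCat k) (X Y Z : C)
    (i : hom X Y) (p : hom Y Z) : Prop :=
  is_kernel p i /\ is_cokernel i p.

Definition simple_obj (k : fieldType) (C : linCat k) (S : C) : Prop :=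
  ~ is_zero S /\
  forall (Y : C) (i : hom Y S), mono i -> is_zero Y \/ is_iso i.

Definition projective (k : fieldType) (C : linCat k) (P : C) : Prop :=
  forall (X Y : C) (e : hom X Y) (f : hom P Y), epi e ->
    exists g : hom P X, e ∘ g = f.

Inductive finite_length (k : fieldType) (C : linCat k) : C -> Prop :=
| FiniteLength0 X : is_zero X -> finite_length X
| FiniteLengthS X Y S (i : hom Y X) (p : hom X S) :
    short_exact i p -> simple_obj S -> finite_length Y -> finite_length X.

(* L lists representatives of the isomorphism classes of simple objects,
   without repetition. *)
Definition is_Irr (k : fieldType) (C : linCat k) (n : nat) (L : 'I_n -> C) : Prop :=
  [/\ forall i, simple_obj (L i),
      forall i j, isomorphic (L i) (L j) -> i = j
    & forall S : C, simple_obj S -> exists i, isomorphic S (L i)].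

Definition finite_abelian (k : fieldType) (C : linCat k) : Prop :=
  [/\ abelian_cat C,
      forall X : C, finite_length X,
      forall X : C, exists P (e : hom P X), projective P /\ epi e
    & exists (n : nat) (L : 'I_n -> C), is_Irr L].

Definition semisimple (k : fieldType) (C : linCat k) : Prop :=
  forall X : C, exists (n : nat) (S : 'I_n -> C),
    (forall j, simple_obj (S j)) /\ is_direct_sum S X.

(* * Monoidal categories *)

Record monoidal (k : fieldType) (C : linCat k) := Monoidal {
  tens : C -> C -> C;
  unit_obj : C;
  tensm : forall a a' b b' : C,
    hom a a' -> hom b b' -> hom (tens a b) (tens a' b');
  tensm1 : forall a b, tensm (idm a) (idm b) = idm (tens a b);
  tensm_comp : forall a a' a'' b b' b''
    (f' : hom a' a'') (f : hom a a') (g' : hom b' b'') (g : hom b b'),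
    tensm (f' ∘ f) (g' ∘ g) = tensm f' g' ∘ tensm f g;
  tensm_linl : forall a a' b b' (g : hom b b'),
    linear (fun f : hom a a' => tensm f g);
  tensm_linr : forall a a' b b' (f : hom a a'),
    linear (fun g : hom b b' => tensm f g);
  assoc : forall a b c, hom (tens (tens a b) c) (tens a (tens b c));
  assoc_inv : forall a b c, hom (tens a (tens b c)) (tens (tens a b) c);
  lunit : forall a, hom (tens unit_obj a) a;
  runit : forall a, hom (tens a unit_obj) a;
  assocK : forall a b c, inverse_pair (assoc a b c) (assoc_inv a b c);
  lunit_iso : forall a, is_iso (lunit a);
  runit_iso : forall a, is_iso (runit a);
  assoc_nat : forall a a' b b' c c'
    (f : hom a a') (g : hom b b') (h : hom c c'),
    assoc a' b' c' ∘ tensm (tensm f g) h = tensm f (tensm g h) ∘ assoc a b c;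
  lunit_nat : forall a a' (f : hom a a'),
    lunit a' ∘ tensm (idm unit_obj) f = f ∘ lunit a;
  runit_nat : forall a a' (f : hom a a'),
    runit a' ∘ tensm f (idm unit_obj) = f ∘ runit a;
  pentagon : forall a b c d,
    tensm (idm a) (assoc b c d) ∘ assoc a (tens b c) d
      ∘ tensm (assoc a b c) (idm d)
    = assoc a b (tens c d) ∘ assoc (tens a b) c d;
  triangle : forall a b,
    tensm (idm a) (lunit b) ∘ assoc a unit_obj b = tensm (runit a) (idm b)
}.

(* Y is a left dual of X, equivalently X is a right dual of Y: the two zigzag
   identities for ev : Y ⊗ X -> 1 and coev : 1 -> X ⊗ Y, with unitors moved
   to the other side. *)
Definition dual_pair (k : fieldType) (C : linCat k) (T : monoidal C)
    (Y X : C) : Prop :=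
  exists (ev : hom (tens T Y X) (unit_obj T))
         (coev : hom (unit_obj T) (tens T X Y)),
    runit T X ∘ tensm T (idm X) ev ∘ assoc T X Y X ∘ tensm T coev (idm X)
      = lunit T X /\
    lunit T Y ∘ tensm T ev (idm Y) ∘ assoc_inv T Y X Y ∘ tensm T (idm Y) coev
      = runit T Y.

Definition rigid (k : fieldType) (C : linCat k) (T : monoidal C) : Prop :=
  forall X : C,
    (exists Y : C, dual_pair T Y X) /\ (exists Y : C, dual_pair T X Y).

Record fusionCat (k : fieldType) := FusionCat {
  fusion_cat :> linCat k;
  fusion_tensor : monoidal fusion_cat;
  fusion_finite_abelian : finite_abelian fusion_cat;
  fusion_semisimple : semisimple fusion_cat;
  fusion_rigid : rigid fusion_tensor;
  fusion_unit_simple : simple_obj (unit_obj fusion_tensor)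
}.

(* * Module categories *)

Record endofunctor (k : fieldType) (M : linCat k) := Endofunctor {
  fobj :> M -> M;
  fmap : forall a b, hom a b -> hom (fobj a) (fobj b);
  fmap1 : forall a, fmap (idm a) = idm (fobj a);
  fmap_comp : forall a b c (g : hom b c) (f : hom a b),
    fmap (g ∘ f) = fmap g ∘ fmap f;
  fmap_lin : forall a b, linear (@fmap a b)
}.

(* A linear (strong) monoidal functor act : C -> End(M) into the strict
   monoidal category of linear endofunctors of M, the monoidal product of
   which is composition.  Natural transformations are given by their
   components: actm f is the image of the morphism f, act_mul X Y is the
   isomorphism act X \o act Y -> act (X ⊗ Y), and act_unit is the isomorphism
   id -> act 1.  The last three axioms are the coherence of a monoidal
   functor. *)
Record module_structure (k : fieldType) (C : linCat k) (T : monoidal C)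
    (M : linCat k) := ModuleStructure {
  act :> C -> endofunctor M;
  actm : forall X Y : C, hom X Y -> forall a : M, hom (act X a) (act Y a);
  actm_nat : forall (X Y : C) (f : hom X Y) (a b : M) (u : hom a b),
    actm f b ∘ fmap (act X) u = fmap (act Y) u ∘ actm f a;
  actm1 : forall (X : C) (a : M), actm (idm X) a = idm (act X a);
  actm_comp : forall (X Y Z : C) (g : hom Y Z) (f : hom X Y) (a : M),
    actm (g ∘ f) a = actm g a ∘ actm f a;
  actm_lin : forall (X Y : C) (a : M), linear (fun f : hom X Y => actm f a);
  act_mul : forall (X Y : C) (a : M), hom (act X (act Y a)) (act (tens T X Y) a);
  act_unit : forall a : M, hom a (act (unit_obj T) a);
  act_mul_iso : forall X Y a, is_iso (act_mul X Y a);
  act_unit_iso : forall a, is_iso (act_unit a);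
  act_mul_nat : forall (X Y : C) (a b : M) (u : hom a b),
    act_mul X Y b ∘ fmap (act X) (fmap (act Y) u)
    = fmap (act (tens T X Y)) u ∘ act_mul X Y a;
  act_unit_nat : forall (a b : M) (u : hom a b),
    act_unit b ∘ u = fmap (act (unit_obj T)) u ∘ act_unit a;
  act_mul_natC : forall (X X' Y Y' : C) (f : hom X X') (g : hom Y Y') (a : M),
    act_mul X' Y' a ∘ (actm f (act Y' a) ∘ fmap (act X) (actm g a))
    = actm (tensm T f g) a ∘ act_mul X Y a;
  act_assoc : forall (X Y Z : C) (a : M),
    actm (assoc T X Y Z) a ∘ act_mul (tens T X Y) Z a ∘ act_mul X Y (act Z a)
    = act_mul X (tens T Y Z) a ∘ fmap (act X) (act_mul Y Z a);
  act_lunit : forall (X : C) (a : M),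
    actm (lunit T X) a ∘ act_mul (unit_obj T) X a ∘ act_unit (act X a)
    = idm (act X a);
  act_runit : forall (X : C) (a : M),
    actm (runit T X) a ∘ act_mul X (unit_obj T) a ∘ fmap (act X) (act_unit a)
    = idm (act X a)
}.

Record fssModCat (k : fieldType) (C : fusionCat k) := FssModCat {
  mod_cat :> linCat k;
  mod_act : module_structure (fusion_tensor C) mod_cat;
  mod_finite_abelian : finite_abelian mod_cat;
  mod_semisimple : semisimple mod_cat
}.

(* * Frobenius-Perron dimension *)

(* [jh_mult L X u]: X has a composition series in which L i occurs u i times. *)
Inductive jh_mult (k : fieldType) (C : linCat k) (n : nat) (L : 'I_n -> C) :
  C -> {ffun 'I_n -> nat} -> Prop :=
| JhMult0 X : is_zero X -> jh_mult L X [ffun=> 0%N]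
| JhMultS X Y l (i : hom Y X) (p : hom X (L l)) (u : {ffun 'I_n -> nat}) :
    short_exact i p -> jh_mult L Y u ->
    jh_mult L X [ffun j => (u j + (j == l))%N].

(* The class of X in the Grothendieck group, the free abelian group on the
   simple objects L i: the family of multiplicities [X : L i]. *)
Definition gr_class (k : fieldType) (C : linCat k) (n : nat) (L : 'I_n -> C)
    (X : C) : {ffun 'I_n -> nat} :=
  xget [ffun=> 0%N] [set u | jh_mult L X u]%classic.

(* Left multiplication by [P] in the Grothendieck ring, where the product is
   [P] [X] = [P ⊗ X]; column j holds the coordinates of [P] [L j]. *)
Definition lmult_mx (R : realType) (k : fieldType) (C : fusionCat k) (n : nat)
    (L : 'I_n -> C) (P : C) : 'M[R]_n :=
  \matrix_(i, j) (gr_class L (tens (fusion_tensor C) P (L j)) i)%:R.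

(* The largest nonnegative real eigenvalue; for nonnegative matrices of
   positive size it exists by the Frobenius-Perron theorem, and as the set of
   eigenvalues is finite its supremum is its maximum. *)
Definition FPeigenvalue (R : realType) (n : nat) (A : 'M[R]_n) : R :=
  sup [set x : R | 0 <= x /\ eigenvalue A x]%classic.

Definition FPdim (R : realType) (k : fieldType) (C : fusionCat k) (n : nat)
    (L : 'I_n -> C) (P : C) : R :=
  FPeigenvalue (lmult_mx R L P).

(* * Quivers *)

(* A finite quiver up to renaming of its arrows: [arrows x y] is the number of
   arrows from x to y. *)
Record quiver := Quiver {
  vertex :> finType;
  arrows : vertex -> vertex -> nat
}.

Definition quiver_iso (Q Q' : quiver) : Prop :=
  exists f : Q -> Q',
    bijective f /\ forall x y, arrows (f x) (f y) = arrows x y.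

Definition quiver_sum (J : finType) (D : J -> quiver) : quiver :=
  @Quiver {j : J & D j} (fun u v =>
    if tag u == tag v then arrows (tagged u) (tagged_as u v) else 0%N).

(* (x, false) is (x, left) and (x, true) is (x, right). *)
Definition separated (Q : quiver) : quiver :=
  @Quiver (Q * bool)%type (fun u v =>
    if ~~ u.2 && v.2 then arrows u.1 v.1 else 0%N).

Definition McKay_quiver (k : fieldType) (C : fusionCat k) (M : fssModCat C)
    (n : nat) (L : 'I_n -> M) (P : C) : quiver :=
  @Quiver 'I_n (fun i j => \dim {: hom (mod_act M P (L i)) (L j)}).

(* * Dynkin diagrams *)

Inductive dynkin :=
| DynA n of (1 <= n)%N
| DynD n of (4 <= n)%N
| DynE6
| DynE7
| DynE8.

Definition dyn_rank (t : dynkin) : nat :=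
  match t with
  | DynA n _ => n
  | DynD n _ => n
  | DynE6 => 6
  | DynE7 => 7
  | DynE8 => 8
  end.

(* The vertices are 0, ..., n - 1.  In types D and E the vertices
   0, ..., n - 2 form a path and n - 1 is attached to its vertex b. *)
Definition branch_edge (n b i j : nat) : bool :=
  ((j == i.+1) && (j < n.-1)%N) || ((i == b) && (j == n.-1)).

Definition dyn_edge (t : dynkin) (i j : nat) : bool :=
  match t with
  | DynA _ _ => j == i.+1
  | DynD n _ => branch_edge n (n - 3) i j
  | DynE6 => branch_edge 6 2 i j
  | DynE7 => branch_edge 7 2 i j
  | DynE8 => branch_edge 8 2 i j
  end.

Definition dyn_adj (t : dynkin) (i j : nat) : bool :=
  dyn_edge t i j || dyn_edge t j i.

(* The simple reflection e_j |-> e_j - c_ij e_i of the geometric (faithful)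
   representation of the Coxeter group in the basis of simple roots, where
   c_ij = 2 delta_ij - [i and j adjacent]. *)
Definition simple_refl (t : dynkin) (i : 'I_(dyn_rank t)) : 'M[int]_(dyn_rank t) :=
  \matrix_(l, j) ((l == j)%:R - (l == i)%:R * ((i == j).*2%:R - (dyn_adj t i j)%:R)).

Definition Coxeter_elt (t : dynkin) : 'M[int]_(dyn_rank t) :=
  \prod_(i < dyn_rank t) simple_refl i.

(* The Coxeter number is the order of a Coxeter element. *)
Definition is_Coxeter_number (t : dynkin) (m : nat) : Prop :=
  [/\ (0 < m)%N, Coxeter_elt t ^+ m = 1
    & forall j, (0 < j < m)%N -> Coxeter_elt t ^+ j <> 1].

(* The underlying graph of Q is the diagram t; for x = y the equation forbids
   loops. *)
Definition ADE_quiver (t : dynkin) (Q : quiver) : Prop :=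
  exists f : 'I_(dyn_rank t) -> Q, bijective f /\
    forall i j, (arrows (f i) (f j) + arrows (f j) (f i))%N = dyn_adj t i j.

Definition disjoint_union_ADE (m : nat) (Q : quiver) : Prop :=
  exists (J : finType) (D : J -> quiver) (t : J -> dynkin),
    (forall j, ADE_quiver (t j) (D j) /\ is_Coxeter_number (t j) m) /\
    quiver_iso Q (quiver_sum D).

(* Main.v *)
From HB Require Import structures.
From mathcomp Require Import all_boot all_order all_algebra.
From mathcomp Require Import boolp classical_sets reals trigo.
From mathcomp Require Import interval_inference topology normedtype derive.
From mathcomp Require Import zify ring lra.
Require Import Defs.

Set Implicit Arguments.
Unset Strict Implicit.
Unset Printing Implicit Defensive.

Import Order.TTheory GRing.Theory Num.Theory.
Import numFieldNormedType.Exports.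
Local Open Scope ring_scope.
Local Open Scope lincat_scope.

(** The correspondence is a statement about one number d = FPdim Pi and one
    graph, the underlying graph G of the separated McKay quiver, which are
    linked by a positive vector on the simple objects of M.

    In the Grothendieck ring of C, right multiplication by the sum of all
    simple objects is a matrix with positive entries, because C is rigid. Its
    Perron eigenvector is unique up to scaling and the left multiplications
    commute with it, so it is an eigenvector of every left multiplication
    ([fusion_eigenvector]); the eigenvalues are the Frobenius-Perron
    dimensions. Acting with it on the sum of the simple objects of M gives a
    positive vector v that is an eigenvector of Pi for d. The matrix of a dual
    of Pi on M is the transpose of that of Pi, since the actions of Pi and of
    its dual are adjoint; so v is also an eigenvector of the transpose, for the
    same d ([module_eigenvector]). Hence two copies of v form a positive
    eigenvector of the adjacency matrix of G for d, on every component of G at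
    once.

    What remains is the classical theory of graphs of spectral radius less
    than 2. If d < 2, then G contains no affine diagram, since pairing v with
    the marks of the diagram would give d >= 2 ([no_affine_subgraph]). Applied
    to a longest path of a component, this leaves the diagrams of types A, D
    and E only ([component_dynkin]). Conversely each Dynkin diagram with Coxeter
    number h has an explicit positive eigenvector with eigenvalue 2 cos (pi / h)
    ([dynkin_spectrum]), and a symmetric matrix has at most one eigenvalue with
    a positive eigenvector; so d = 2 cos (pi / h) as soon as one component of G
    is a Dynkin diagram with Coxeter number h. As the cosine is injective on
    the interval from 0 to pi, this determines h.

    The Coxeter number is the order of the Coxeter element. In types A and D
    this is a cycle, resp. a signed permutation, in the usual
    coordinates of the root system ([coxeter_number_A], [coxeter_number_D]); in type E the orbits of the
    simple roots are computed ([coxeter_checkP]). *)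


(** * Bilinear composition and dimensions of Hom spaces *)

Section Bilinear.
Variables (k : fieldType) (C : linCat k).

(** Composition with a fixed morphism is named so that it can carry a linear
    structure. *)
Definition precomp (a b c : C) (f : hom a b) (g : hom b c) : hom a c := g ∘ f.
Definition postcomp (a b c : C) (g : hom b c) (f : hom a b) : hom a c := g ∘ f.

HB.instance Definition _ (a b c : C) (f : hom a b) :=
  GRing.isLinear.Build k (hom b c) (hom a c) _ (@precomp a b c f)
    (comp_linl (c := c) f).
HB.instance Definition _ (a b c : C) (g : hom b c) :=
  GRing.isLinear.Build k (hom a b) (hom a c) _ (@postcomp a b c g)
    (comp_linr (a := a) g).

Lemma comp0m (a b c : C) (f : hom a b) : (0 : hom b c) ∘ f = 0.
Proof. exact: (linear0 (precomp f)). Qed.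

Lemma compm0 (a b c : C) (g : hom b c) : g ∘ (0 : hom a b) = 0.
Proof. exact: (linear0 (postcomp g)). Qed.

Lemma compDl (a b c : C) (f : hom a b) (g h : hom b c) :
  (g + h) ∘ f = g ∘ f + h ∘ f.
Proof. exact: (linearD (precomp f)). Qed.

Lemma compBl (a b c : C) (f : hom a b) (g h : hom b c) :
  (g - h) ∘ f = g ∘ f - h ∘ f.
Proof. exact: (linearB (precomp f)). Qed.

Lemma compBr (a b c : C) (g : hom b c) (f h : hom a b) :
  g ∘ (f - h) = g ∘ f - g ∘ h.
Proof. exact: (linearB (postcomp g)). Qed.

Lemma compZl (a b c : C) (f : hom a b) x (g : hom b c) :
  (x *: g) ∘ f = x *: (g ∘ f).
Proof. exact: (linearZ_LR (precomp f)). Qed.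

Lemma comp_suml (a b c : C) (f : hom a b) n (g : 'I_n -> hom b c) :
  (\sum_j g j) ∘ f = \sum_j g j ∘ f.
Proof. exact: (linear_sum (precomp f)). Qed.

Lemma comp_sumr (a b c : C) (g : hom b c) n (f : 'I_n -> hom a b) :
  g ∘ (\sum_j f j) = \sum_j g ∘ f j.
Proof. exact: (linear_sum (postcomp g)). Qed.

End Bilinear.

Notation dim_hom a b := (\dim {: hom a b}).

Lemma leq_dim_inj (k : fieldType) (U V : vectType k) (f : {linear U -> V}) :
  injective f -> (\dim {: U} <= \dim {: V})%N.
Proof.
move=> f_inj.
have := @limg_dim_eq k U V (linfun f) fullv.
rewrite (_ : lker _ = 0%VS); first by rewrite capv0 => <- //; apply/dimvS/subvf.
apply/eqP/lker0P => x y; rewrite !lfunE; exact: f_inj.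
Qed.

Lemma eq_dim_bij (k : fieldType) (U V : vectType k) (f : {linear U -> V})
    (g : V -> U) : cancel f g -> cancel g f -> \dim {: U} = \dim {: V}.
Proof.
move=> fK gK; apply/eqP; rewrite eqn_leq (leq_dim_inj (can_inj fK)) /=.
have glin : linear g by move=> a x y; apply: (can_inj fK); rewrite linearP !gK.
pose gL := GRing.isLinear.Build k V U _ g glin.
pose g' : {linear V -> U} := HB.pack g gL.
exact: (@leq_dim_inj _ _ _ g' (can_inj gK)).
Qed.

Section Isomorphism.
Variables (k : fieldType) (C : linCat k).
Implicit Types a b c : C.

Lemma dim_hom_isol a b c : isomorphic a b -> dim_hom a c = dim_hom b c.
Proof.
case=> f [g [gf fg]].
apply: (@eq_dim_bij _ _ _ (@precomp k C b a c g) (@precomp k C a b c f)) => h.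
  by rewrite /= /precomp -compA gf compm1.
by rewrite /= /precomp -compA fg compm1.
Qed.

Lemma dim_hom_isor a b c : isomorphic a b -> dim_hom c a = dim_hom c b.
Proof.
case=> f [g [gf fg]].
apply: (@eq_dim_bij _ _ _ (@postcomp k C c a b f) (@postcomp k C c b a g)) => h.
  by rewrite /= /postcomp compA gf comp1m.
by rewrite /= /postcomp compA fg comp1m.
Qed.

Lemma dim_hom0 a b : (forall f : hom a b, f = 0) -> dim_hom a b = 0%N.
Proof.
move=> h0; apply/eqP; rewrite dimv_eq0 -subv0; apply/subvP => x _.
by rewrite (h0 x) mem0v.
Qed.

Lemma dim_hom_gt0 a b (f : hom a b) : f != 0 -> (0 < dim_hom a b)%N.
Proof.
move=> nz; rewrite lt0n dimv_eq0; apply: contra nz => /eqP h.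
by rewrite -memv0 -h memvf.
Qed.

(** Composition with the projections embeds each Hom (S j, b) in Hom (a, b); as
    the identity of a is the sum of the idempotents of the S j, these subspaces
    span, and by orthogonality of the idempotents their sum is direct. *)
Lemma dim_hom_sum_l n (S : 'I_n -> C) a b :
  is_direct_sum S a -> dim_hom a b = (\sum_j dim_hom (S j) b)%N.
Proof.
case=> i [p [pi1 pi0 ip]].
pose phi j := linfun (@precomp k C a (S j) b (p j)).
have phiP j f : f \in limg (phi j) -> f = f ∘ i j ∘ p j.
  by case/memv_imgP => g _ ->; rewrite lfunE /= /precomp -!compA (compA (p j))
    pi1 comp1m.
have phi0 j l f : j != l -> f \in limg (phi l) -> f ∘ i j = 0.
  move=> jl; case/memv_imgP => g _ ->.
  by rewrite lfunE /= /precomp -compA pi0 1?eq_sym // compm0.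
have dphi j : \dim (limg (phi j)) = dim_hom (S j) b.
  apply: limg_dim_eq; suff -> : lker (phi j) = 0%VS by rewrite capv0.
  apply/eqP/lker0P => g h; rewrite !lfunE /= /precomp => e.
  by rewrite -(compm1 g) -(compm1 h) -pi1 !compA e.
have dir : directv (\sum_j limg (phi j)).
  apply/directv_sum_independent => us usP us0 j _.
  rewrite (phiP j _ (usP j isT)) -(comp0m b (p j)); congr (_ ∘ _).
  rewrite -(comp0m b (i j)) -us0 comp_suml (bigD1 j) //= big1 ?addr0 //.
  by move=> l lj; apply: (phi0 _ l); rewrite 1?eq_sym // usP.
rewrite -(eq_bigr _ (fun j _ => dphi j)) -(directvP dir) /=.
congr (\dim _); apply/eqP; rewrite eq_sym eqEsubv subvf /=.
apply/subvP => f _; rewrite -(compm1 f) -ip comp_sumr.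
apply: memv_sumr => j _; rewrite compA.
by apply/memv_imgP; exists (f ∘ i j); rewrite ?memvf // lfunE.
Qed.

Lemma dim_hom_sum_r n (S : 'I_n -> C) a b :
  is_direct_sum S a -> dim_hom b a = (\sum_j dim_hom b (S j))%N.
Proof.
case=> i [p [pi1 pi0 ip]].
pose phi j := linfun (@postcomp k C b (S j) a (i j)).
have phiP j f : f \in limg (phi j) -> f = i j ∘ (p j ∘ f).
  by case/memv_imgP => g _ ->; rewrite lfunE /= /postcomp !compA -(compA (i j))
    pi1 compm1.
have phi0 j l f : j != l -> f \in limg (phi l) -> p j ∘ f = 0.
  move=> jl; case/memv_imgP => g _ ->.
  by rewrite lfunE /= /postcomp compA pi0 // comp0m.
have dphi j : \dim (limg (phi j)) = dim_hom b (S j).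
  apply: limg_dim_eq; suff -> : lker (phi j) = 0%VS by rewrite capv0.
  apply/eqP/lker0P => g h; rewrite !lfunE /= /postcomp => e.
  by rewrite -(comp1m g) -(comp1m h) -pi1 -!compA e.
have dir : directv (\sum_j limg (phi j)).
  apply/directv_sum_independent => us usP us0 j _.
  rewrite (phiP j _ (usP j isT)) -(compm0 b (i j)); congr (_ ∘ _).
  rewrite -(compm0 b (p j)) -us0 comp_sumr (bigD1 j) //= big1 ?addr0 //.
  by move=> l lj; apply: (phi0 _ l); rewrite 1?eq_sym // usP.
rewrite -(eq_bigr _ (fun j _ => dphi j)) -(directvP dir) /=.
congr (\dim _); apply/eqP; rewrite eq_sym eqEsubv subvf /=.
apply/subvP => f _; rewrite -(comp1m f) -ip comp_suml.
apply: memv_sumr => j _; rewrite -compA.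
by apply/memv_imgP; exists (p j ∘ f); rewrite ?memvf // lfunE.
Qed.

End Isomorphism.

(** * Semisimple categories *)

Section FunctorDimension.
Variables (k : fieldType) (C D : linCat k).
Variables (F : C -> D) (Fm : forall a b, hom a b -> hom (F a) (F b)).
Hypothesis Fm1 : forall a, Fm (idm a) = idm (F a).
Hypothesis Fm_comp : forall a b c (g : hom b c) (f : hom a b),
  Fm (g ∘ f) = Fm g ∘ Fm f.
Hypothesis Fm_lin : forall a b, linear (@Fm a b).

HB.instance Definition _ (a b : C) :=
  GRing.isLinear.Build k (hom a b) (hom (F a) (F b)) _ (@Fm a b) (@Fm_lin a b).

Lemma functor_iso a b : isomorphic a b -> isomorphic (F a) (F b).
Proof.
case=> f [g [gf fg]]; exists (Fm f), (Fm g).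
by split; rewrite -Fm_comp ?gf ?fg Fm1.
Qed.

Lemma functor_direct_sum n (S : 'I_n -> C) a :
  is_direct_sum S a -> is_direct_sum (fun j => F (S j)) (F a).
Proof.
case=> i [p [pi1 pi0 ip]]; exists (fun j => Fm (i j)), (fun j => Fm (p j)).
split=> [j|j l jl|]; first by rewrite -Fm_comp pi1 Fm1.
  by rewrite -Fm_comp pi0 // linear0.
rewrite -Fm1 -ip linear_sum; apply: eq_bigr => j _.
exact/esym/Fm_comp.
Qed.

End FunctorDimension.

Lemma kernel_mono (k : fieldType) (C : linCat k) (K X Y : C)
    (f : hom X Y) (i : hom K X) : is_kernel f i -> mono i.
Proof.
move=> [fi0 iP] W g h e; have [|u [_ uU]] := iP W (i ∘ g).
  by rewrite compA fi0 comp0m.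
by rewrite -(uU g) // -(uU h).
Qed.

Section Semisimple.
Variables (k : closedFieldType) (C : linCat k).
Hypothesis abC : abelian_cat C.
Implicit Types (X Y Z S : C).

Lemma is_zero_idm X : idm X = 0 -> is_zero X.
Proof.
by move=> h; split=> Y f; [rewrite -(compm1 f)|rewrite -(comp1m f)];
  rewrite h ?compm0 ?comp0m.
Qed.

(** Schur's lemma: the kernel of f is zero, as it is not all of S, so f is a
    nonzero subobject of the simple object S'. *)
Lemma schur_iso S S' (f : hom S S') :
  simple_obj S -> simple_obj S' -> f != 0 -> is_iso f.
Proof.
case: abC => _ kerC _ _ _ [S0 sS] [S'0 sS'] f0.
have [K [i iK]] := kerC _ _ f; have [fi0 iP] := iK.
have [[K0 K0']|[j [_ ij]]] := sS _ _ (kernel_mono iK); last first.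
  by case/eqP: f0; rewrite -(compm1 f) -ij compA fi0 comp0m.
have f_mono : mono f.
  move=> W g h e; apply/subr0_eq.
  have [|u [<- _]] := iP W (g - h); first by rewrite compBr e subrr.
  by rewrite (K0' _ u) compm0.
by have [|] := sS' _ _ f_mono.
Qed.

(** Over an algebraically closed field, composition with an endomorphism f of
    a simple object has an eigenvalue x, so that f - x id is not invertible,
    hence zero. *)
Lemma dim_end_simple S : simple_obj S -> dim_hom S S = 1%N.
Proof.
move=> sS; have [S0 _] := sS.
have id0 : idm S != 0 by apply/eqP => /is_zero_idm.
suff scalar (f : hom S S) : exists x, f = x *: idm S.
  have -> : fullv = <[idm S]>%VS; last by rewrite dim_vline id0.
  apply/eqP; rewrite eq_sym eqEsubv subvf /=; apply/subvP => f _.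
  by have [x ->] := scalar f; rewrite memvZ // memv_line.
pose phi := linfun (@postcomp k C S S S f).
have e_basis := vbasisP {: hom S S}.
have [x] : exists x, eigenvalue (passmx.mxof (vbasis fullv) (vbasis fullv) phi) x.
  have [|x rx] := closed_rootP
    (char_poly (passmx.mxof (vbasis fullv) (vbasis fullv) phi)) _.
    rewrite size_char_poly eqSS -lt0n; exact: dim_hom_gt0 id0.
  by exists x; rewrite eigenvalue_root_char.
rewrite /eigenvalue -(passmx.vsof_eq0 e_basis) -passmx.leigenspaceE // => nz.
have [g] : exists2 g, g \in passmx.leigenspace phi x & g != 0.
  by exists (vpick (passmx.leigenspace phi x)); rewrite ?memv_pick // vpick0.
rewrite memv_ker !lfun_simp /= /postcomp => /eqP e g0; exists x.
have [//|nz'] := eqVneq f (x *: idm S).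
have [|h [hf _]] := @schur_iso _ _ (f - x *: idm S) sS sS.
  by rewrite subr_eq0.
case/eqP: g0; rewrite -(comp1m g) -hf -compA.
by rewrite compBl compZl comp1m e compm0.
Qed.

Lemma dim_hom_simple0 S S' :
  simple_obj S -> simple_obj S' -> ~ isomorphic S S' -> dim_hom S S' = 0%N.
Proof.
move=> sS sS' nS; apply: dim_hom0 => f; have [//|f0] := eqVneq f 0.
by case: nS; exists f; apply: schur_iso.
Qed.

Hypothesis ssC : semisimple C.
Variables (n : nat) (L : 'I_n -> C).
Hypothesis irrL : is_Irr L.

Lemma dim_hom_irr i j : dim_hom (L i) (L j) = (i == j).
Proof.
case: irrL => sL injL _; have [->|/eqP ij] := eqVneq i j.
  exact: dim_end_simple.
by apply: dim_hom_simple0 => // /injL.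
Qed.

Lemma irr_decomposition X : exists m (S : 'I_m -> C) (s : 'I_m -> 'I_n),
  (forall j, isomorphic (S j) (L (s j))) /\ is_direct_sum S X.
Proof.
case: irrL => _ _ allL; have [m [S [sS dS]]] := ssC X.
have [s sP] := choice (fun j => allL _ (sS j)).
by exists m, S, s.
Qed.

(** Both sides count the summands of X isomorphic to L i. *)
Lemma dim_hom_irrC X i : dim_hom X (L i) = dim_hom (L i) X.
Proof.
have [m [S [s [sP dS]]]] := irr_decomposition X.
rewrite (dim_hom_sum_l _ dS) (dim_hom_sum_r _ dS); apply: eq_bigr => j _.
by rewrite (dim_hom_isol _ (sP j)) (dim_hom_isor _ (sP j)) !dim_hom_irr eq_sym.
Qed.

(** The multiplicities of a linear functor are determined on simple objects:
    this is the matrix of the induced map of Grothendieck groups. *)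
Lemma dim_hom_functor (D : linCat k) (F : C -> D)
    (Fm : forall a b, hom a b -> hom (F a) (F b)) X (Z : D) :
  (forall a, Fm _ _ (idm a) = idm (F a)) ->
  (forall a b c (g : hom b c) (f : hom a b),
     Fm _ _ (g ∘ f) = Fm _ _ g ∘ Fm _ _ f) ->
  (forall a b, linear (@Fm a b)) ->
  dim_hom (F X) Z = (\sum_l dim_hom X (L l) * dim_hom (F (L l)) Z)%N.
Proof.
move=> F1 Fc Fl; have [m [S [s [sP dS]]]] := irr_decomposition X.
rewrite (dim_hom_sum_l _ (functor_direct_sum F1 Fc Fl dS)).
under eq_bigr do rewrite (dim_hom_isol _ (functor_iso F1 Fc (sP _))).
under [RHS]eq_bigr do rewrite (dim_hom_sum_l _ dS) big_distrl.
rewrite exchange_big /=; apply: eq_bigr => j _.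
rewrite (bigD1 (s j)) //= big1 ?addn0 => [|l lj].
  by rewrite (dim_hom_isol _ (sP j)) dim_hom_irr eqxx mul1n.
by rewrite (dim_hom_isol _ (sP j)) dim_hom_irr eq_sym (negPf lj).
Qed.

(** The restriction of p to some simple summand of X is nonzero, hence
    invertible. *)
Lemma nonzero_to_simple_splits X S (p : hom X S) :
  simple_obj S -> p != 0 -> exists s : hom S X, p ∘ s = idm S.
Proof.
move=> sS p0; have [m [T [sT [i [q [_ _ iq]]]]]] := ssC X.
have [j pj] : exists j, p ∘ i j != 0.
  apply/existsP; apply: contraNT p0 => /existsPn h.
  rewrite -(compm1 p) -iq comp_sumr big1 // => j _.
  by move/negPn/eqP: (h j) => e; rewrite compA e comp0m.
have [g [_ fg]] := schur_iso (sT j) sS pj.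
by exists (i j ∘ g); rewrite compA.
Qed.

(** The sequence splits because its third term is simple. *)
Lemma dim_hom_short_exact X Y S Z (i : hom Y X) (p : hom X S) :
  short_exact i p -> simple_obj S ->
  dim_hom X Z = (dim_hom Y Z + dim_hom S Z)%N.
Proof.
move=> [iK [_ pP]] sS; have [pi0 iP] := iK; have [S0 _] := sS.
have [|s ps] := @nonzero_to_simple_splits _ _ p sS.
  apply/eqP => p0; apply: S0; apply: is_zero_idm.
  have [|u [_ uU]] := pP S p; first by rewrite pi0.
  by rewrite -(uU (idm S)) ?comp1m // -(uU 0) // p0 comp0m.
have [|t [it _]] := iP _ (idm X - s ∘ p).
  by rewrite compBr compm1 compA ps comp1m subrr.
have i_mono := kernel_mono iK.
have ti : t ∘ i = idm Y.
  by apply: i_mono; rewrite compA it compBl comp1m -compA pi0 compm0 subr0 compm1.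
have ts : t ∘ s = 0.
  apply: i_mono; rewrite compA it compBl comp1m -compA ps compm1 subrr.
  by rewrite compm0.
pose phi (f : hom X Z) : (hom Y Z * hom S Z)%type := (f ∘ i, f ∘ s).
have phi_lin : linear phi.
  move=> a f g; rewrite /phi; congr (_, _).
    exact: (linearP (precomp i)).
  exact: (linearP (precomp s)).
pose phiM := GRing.isLinear.Build k (hom X Z) _ _ phi phi_lin.
pose phiL : {linear hom X Z -> (hom Y Z * hom S Z)%type} := HB.pack phi phiM.
rewrite (@eq_dim_bij _ _ _ phiL (fun u => u.1 ∘ t + u.2 ∘ p)) ?dimvf //.
  move=> f /=; rewrite -!compA it compBr compm1 compA.
  by rewrite subrK.
move=> [g h]; rewrite /= /phi; congr (_, _).
  by rewrite compDl -!compA ti pi0 compm1 compm0 addr0.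
by rewrite compDl -!compA ts ps compm1 compm0 add0r.
Qed.

Lemma jh_multE X u i : jh_mult L X u -> u i = dim_hom X (L i).
Proof.
elim=> {X u} [X [X0 _]|X Y l f p u sE _ IH].
  by rewrite ffunE dim_hom0.
have sL : simple_obj (L l) by case: irrL.
by rewrite ffunE IH (dim_hom_short_exact _ sE sL) dim_hom_irr eq_sym.
Qed.

Lemma jh_mult_ex X : finite_length X -> exists u, jh_mult L X u.
Proof.
elim=> {X} [X X0|X Y S i p [iK pC] sS _ [u uP]].
  by exists [ffun=> 0%N]; constructor.
have [l [f [g [gf fg]]]] : exists l, isomorphic S (L l) by case: irrL => _ _; apply.
have cancel_f W (a b : hom W S) : f ∘ a = f ∘ b -> a = b.
  by move=> e; rewrite -(comp1m a) -(comp1m b) -gf -!compA e.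
eexists; apply: (@JhMultS _ _ _ _ X Y l i (f ∘ p) u) => //; split; split.
- by rewrite -compA (proj1 iK) compm0.
- move=> W h; rewrite -compA => e; apply: (proj2 iK); apply: cancel_f.
  by rewrite e compm0.
- by rewrite -compA (proj1 pC) compm0.
- move=> W h hi; have [v [vp vU]] := proj2 pC _ _ hi.
  exists (v ∘ g); split.
    by rewrite compA -(compA v) gf compm1.
  by move=> w wp; rewrite (vU (w ∘ f)) -?compA ?fg ?compm1.
Qed.

Lemma gr_classE X i : finite_length X -> gr_class L X i = dim_hom X (L i).
Proof.
case/jh_mult_ex=> u uP; apply: jh_multE; rewrite /gr_class.
exact: xgetI uP.
Qed.

End Semisimple.

(** * Dual objects acting on a module category *)

Lemma linear_fun0 (k : fieldType) (U V : lmodType k) (f : U -> V) :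
  linear f -> f 0 = 0.
Proof. by move=> h; have := h (-1) 0 0; rewrite scaler0 addr0 scaleN1r addNr. Qed.

Section Inverse.
Variables (k : fieldType) (C : linCat k).

Definition iso_inv (a b : C) (f : hom a b) (f_iso : is_iso f) : hom b a :=
  sval (cid f_iso).

Lemma iso_invl (a b : C) (f : hom a b) (f_iso : is_iso f) :
  iso_inv f_iso ∘ f = idm a.
Proof. by case: (svalP (cid f_iso)). Qed.

Lemma iso_invr (a b : C) (f : hom a b) (f_iso : is_iso f) :
  f ∘ iso_inv f_iso = idm b.
Proof. by case: (svalP (cid f_iso)). Qed.

End Inverse.

(** For a dual pair (Y, X) acting on a module category, the action of Y is left
    adjoint to that of X: the evaluation and coevaluation act as counit and
    unit, and the zigzag identities for Y and X become, through the coherence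
    of the action, the triangle identities. *)
Section DualAction.
Variables (k : fieldType) (C : linCat k) (T : monoidal C) (M : linCat k).
Variables (A : module_structure T M) (Y X : C).
Variables (ev : hom (tens T Y X) (unit_obj T))
          (coev : hom (unit_obj T) (tens T X Y)).
Hypothesis zigzagX :
  runit T X ∘ tensm T (idm X) ev ∘ assoc T X Y X ∘ tensm T coev (idm X)
    = lunit T X.
Hypothesis zigzagY :
  lunit T Y ∘ tensm T ev (idm Y) ∘ assoc_inv T Y X Y ∘ tensm T (idm Y) coev
    = runit T Y.

Let mulV P Q a := iso_inv (act_mul_iso A P Q a).
Let unitV a := iso_inv (act_unit_iso A a).

Definition coev_act (a : M) : hom a (A X (A Y a)) :=
  mulV X Y a ∘ (actm A coev a ∘ act_unit A a).
Definition ev_act (b : M) : hom (A Y (A X b)) b :=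
  unitV b ∘ (actm A ev b ∘ act_mul A Y X b).

Lemma coev_act_nat (a b : M) (g : hom a b) :
  fmap (A X) (fmap (A Y) g) ∘ coev_act a = coev_act b ∘ g.
Proof.
have mulV_nat : fmap (A X) (fmap (A Y) g) ∘ mulV X Y a
              = mulV X Y b ∘ fmap (A (tens T X Y)) g.
  rewrite -[LHS]comp1m -(iso_invl (act_mul_iso A X Y b)) -/(mulV X Y b).
  by rewrite -!compA (compA (act_mul A X Y b)) act_mul_nat -compA iso_invr compm1.
by rewrite /coev_act compA mulV_nat -!compA (compA (fmap _ g)) -actm_nat -compA
  -act_unit_nat.
Qed.

Lemma ev_act_nat (a b : M) (g : hom a b) :
  ev_act b ∘ fmap (A Y) (fmap (A X) g) = g ∘ ev_act a.
Proof.
have unitV_nat : g ∘ unitV a = unitV b ∘ fmap (A (unit_obj T)) g.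
  rewrite -[LHS]comp1m -(iso_invl (act_unit_iso A b)) -/(unitV b).
  by rewrite -!compA (compA (act_unit A b)) act_unit_nat -compA iso_invr compm1.
by rewrite /ev_act -!compA act_mul_nat (compA (actm A ev b)) actm_nat compA compA
  -unitV_nat -!compA.
Qed.

Lemma triangleX (b : M) : fmap (A X) (ev_act b) ∘ coev_act (A X b) = idm (A X b).
Proof.
rewrite -(act_lunit A X b) -zigzagX !actm_comp -!compA.
have coev_nat := act_mul_natC A coev (idm X) b.
rewrite actm1 fmap1 compm1 in coev_nat.
have ev_nat := act_mul_natC A (idm X) ev b.
rewrite actm1 comp1m in ev_nat.
rewrite (compA (actm A (tensm T coev _) b)) -coev_nat -compA.
rewrite -[actm A coev _ ∘ _]comp1m -(iso_invr (act_mul_iso A X Y (A X b))).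
rewrite -/(mulV X Y (A X b)) -(compA (act_mul A X Y _)) -/(coev_act (A X b)).
rewrite (compA (act_mul A (tens T X Y) X b)) (compA (actm A (assoc T X Y X) b)).
rewrite (compA (actm A (assoc T X Y X) b)) act_assoc -compA.
rewrite (compA (actm A (tensm T _ ev) b)) -ev_nat -!compA.
have runitE : actm A (runit T X) b ∘ act_mul A X (unit_obj T) b
            = fmap (A X) (unitV b).
  rewrite -[LHS]compm1 -fmap1 -(iso_invr (act_unit_iso A b)) fmap_comp compA.
  by rewrite act_runit comp1m.
by rewrite (compA (actm A (runit T X) b)) runitE !compA -!fmap_comp /ev_act !compA.
Qed.

Lemma triangleY (a : M) : ev_act (A Y a) ∘ fmap (A Y) (coev_act a) = idm (A Y a).
Proof.
rewrite -(act_runit A Y a) -zigzagY !actm_comp -!compA.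
have coev_nat := act_mul_natC A (idm Y) coev a.
rewrite actm1 comp1m in coev_nat.
have ev_nat := act_mul_natC A ev (idm Y) a.
rewrite actm1 fmap1 compm1 in ev_nat.
rewrite (compA (actm A (tensm T _ coev) a)) -coev_nat -compA.
have assocVE : actm A (assoc_inv T Y X Y) a ∘ act_mul A Y (tens T X Y) a
   = act_mul A (tens T Y X) Y a ∘ (act_mul A Y X (A Y a) ∘ fmap (A Y) (mulV X Y a)).
  rewrite -[LHS]compm1 -fmap1 -(iso_invr (act_mul_iso A X Y a)) fmap_comp.
  rewrite -/(mulV X Y a) -compA (compA (act_mul A Y _ a)) -act_assoc !compA.
  by rewrite -actm_comp (assocK T Y X Y).1 actm1 comp1m.
rewrite (compA (actm A (assoc_inv _ _ _ _) a)) assocVE -!compA.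
rewrite (compA (actm A (tensm T ev _) a)) -ev_nat -!compA.
have lunitE : actm A (lunit T Y) a ∘ act_mul A (unit_obj T) Y a = unitV (A Y a).
  rewrite -[LHS]compm1 -(iso_invr (act_unit_iso A (A Y a))) compA.
  by rewrite act_lunit comp1m.
by rewrite (compA (actm A (lunit T Y) a)) lunitE /ev_act /coev_act !fmap_comp -?compA.
Qed.

Lemma dim_hom_dual_act (a b : M) : dim_hom (A Y a) b = dim_hom a (A X b).
Proof.
pose phi (f : hom (A Y a) b) : hom a (A X b) := fmap (A X) f ∘ coev_act a.
have phi_lin : linear phi.
  move=> x f g; rewrite /phi fmap_lin.
  exact: (linearP (precomp (coev_act a))).
pose phiM := GRing.isLinear.Build k _ _ _ phi phi_lin.
pose phiL : {linear hom (A Y a) b -> hom a (A X b)} := HB.pack phi phiM.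
apply: (@eq_dim_bij _ _ _ phiL (fun g => ev_act b ∘ fmap (A Y) g)) => [f|g] /=.
  by rewrite /phi fmap_comp compA ev_act_nat -compA triangleY compm1.
by rewrite /phi fmap_comp -compA coev_act_nat compA triangleX comp1m.
Qed.

End DualAction.

Section ModuleMultiplicities.
Variables (k : closedFieldType) (C : fusionCat k) (M : fssModCat C).
Variables (r : nat) (X : 'I_r -> C) (irrX : is_Irr X).
Variables (n : nat) (L : 'I_n -> M) (irrL : is_Irr L).
Local Notation T := (fusion_tensor C).
Local Notation A := (mod_act M).

Let abC : abelian_cat C. Proof. by case: (fusion_finite_abelian C). Qed.
Let abM : abelian_cat M. Proof. by case: (mod_finite_abelian M). Qed.

Lemma dim_act_mod P a b :
  dim_hom (A P a) b = (\sum_l dim_hom a (L l) * dim_hom (A P (L l)) b)%N.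
Proof.
apply: (dim_hom_functor abM (@mod_semisimple _ _ M) irrL (F := A P)
  (Fm := fun a b f => fmap (A P) f)).
- exact: fmap1.
- exact: fmap_comp.
- exact: fmap_lin.
Qed.

Lemma dim_act_cat P a b :
  dim_hom (A P a) b = (\sum_i dim_hom P (X i) * dim_hom (A (X i) a) b)%N.
Proof.
apply: (dim_hom_functor abC (@fusion_semisimple _ C) irrX (F := fun Q => A Q a)
  (Fm := fun P Q f => actm A f a)).
- by move=> Q; exact: actm1.
- by move=> P1 P2 P3 g f; exact: actm_comp.
- by move=> P1 P2; exact: actm_lin.
Qed.

Lemma dim_tensl P Q R :
  dim_hom (tens T P Q) R
    = (\sum_i dim_hom P (X i) * dim_hom (tens T (X i) Q) R)%N.
Proof.
apply: (dim_hom_functor abC (@fusion_semisimple _ C) irrX (F := fun P => tens T P Q)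
  (Fm := fun a b f => tensm T f (idm Q))).
- by move=> a; exact: tensm1.
- by move=> a b c g f; rewrite -{1}(comp1m (idm Q)) tensm_comp.
- by move=> a b; exact: tensm_linl.
Qed.

Lemma dim_tensr P Q R :
  dim_hom (tens T P Q) R
    = (\sum_i dim_hom Q (X i) * dim_hom (tens T P (X i)) R)%N.
Proof.
apply: (dim_hom_functor abC (@fusion_semisimple _ C) irrX (F := fun Q => tens T P Q)
  (Fm := fun a b f => tensm T (idm P) f)).
- by move=> a; exact: tensm1.
- by move=> a b c g f; rewrite -{1}(comp1m (idm P)) tensm_comp.
- by move=> a b; exact: tensm_linr.
Qed.

Lemma dim_tensA P Q R S :
  dim_hom (tens T (tens T P Q) R) S = dim_hom (tens T P (tens T Q R)) S.
Proof.
apply: dim_hom_isol; exists (assoc T P Q R), (assoc_inv T P Q R).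
exact: assocK.
Qed.

Lemma dim_actA P Q a b : dim_hom (A P (A Q a)) b = dim_hom (A (tens T P Q) a) b.
Proof. by apply: dim_hom_isol; exists (act_mul A P Q a); exact: act_mul_iso. Qed.

Lemma dim_act_unit : exists i, forall a b, dim_hom (A (X i) a) b = dim_hom a b.
Proof.
case: irrX => _ _ /(_ _ (fusion_unit_simple C))[i iso_i]; exists i => a b.
rewrite -(dim_hom_isol b (a := A (unit_obj T) a)); last first.
  apply: (functor_iso (F := fun Q => A Q a) (Fm := fun P Q f => actm A f a)) iso_i.
    by move=> Q; exact: actm1.
  by move=> P1 P2 P3 g f; exact: actm_comp.
by apply/esym/dim_hom_isol; exists (act_unit A a); exact: act_unit_iso.
Qed.

(** By adjunction, and because multiplicities of simple objects can be computed
    on either side, P and its dual act by transposed matrices. *)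
Lemma dim_act_dual P : exists P' : C, forall l l',
  dim_hom (A P' (L l)) (L l') = dim_hom (A P (L l')) (L l).
Proof.
have [[P' [ev [coev [zz1 zz2]]]] _] := @fusion_rigid _ C P; exists P' => l l'.
by rewrite (dim_hom_dual_act A zz1 zz2) (dim_hom_irrC abM (@mod_semisimple _ _ M) irrL).
Qed.

(** The unit object is a summand of P ⊗ P' for a dual P' of P, so X k is a
    summand of P ⊗ (P' ⊗ X k). *)
Lemma dim_tens_gt0 j l : exists i, (0 < dim_hom (tens T (X j) (X i)) (X l))%N.
Proof.
case: irrX => sX _ _; have [_ [Y [ev [coev [_ zz]]]]] := @fusion_rigid _ C (X j).
have ev0 : ev != 0.
  apply/eqP => ev0; move: zz; rewrite ev0 (linear_fun0 (tensm_linl T (idm (X j)))).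
  rewrite compm0 !comp0m => ru0; have [X0 _] := sX j; apply: X0.
  apply: is_zero_idm; have [h [_ hr]] := runit_iso T (X j).
  by rewrite -hr -ru0 comp0m.
have [s evs] := nonzero_to_simple_splits abC (@fusion_semisimple _ C)
  (fusion_unit_simple C) ev0.
have gt0 : (0 < dim_hom (tens T (tens T (X j) Y) (X l)) (X l))%N.
  apply: (@dim_hom_gt0 _ _ _ _ (lunit T (X l) ∘ tensm T ev (idm (X l)))).
  apply/eqP => e; have [X0 _] := sX l; apply: X0; apply: is_zero_idm.
  have [h [_ hl]] := lunit_iso T (X l).
  rewrite -hl -[lunit T _]compm1 -tensm1 -evs -[X in tensm T _ X]comp1m tensm_comp.
  by rewrite !compA e !comp0m.
move: gt0; rewrite dim_tensA dim_tensr lt0n sum_nat_eq0 => /forallPn[i] /=.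
by rewrite muln_eq0 negb_or => /andP[_ gt0]; exists i; rewrite lt0n.
Qed.

Lemma gr_class_tensE P i j :
  gr_class X (tens T P (X j)) i = dim_hom (tens T P (X j)) (X i).
Proof.
case: (fusion_finite_abelian C) => _ fl _ _.
exact: (gr_classE abC (@fusion_semisimple _ C) irrX _ (fl _)).
Qed.

End ModuleMultiplicities.

(** * Perron's theorem for positive matrices *)

Section Perron.
Variables (R : realType) (r : nat) (T : 'I_r.+1 -> 'I_r.+1 -> R).
Hypothesis T_gt0 : forall i j, 0 < T i j.
Implicit Types x y : 'I_r.+1 -> R.

Local Notation ap x i := (\sum_j T i j * x j).

Lemma positive_image x : (forall j, 0 <= x j) -> (exists j, x j != 0) ->
  forall i, 0 < ap x i.
Proof.
move=> x0 [j xj] i; rewrite (bigD1 j) //= ltr_wpDr //.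
  by apply: sumr_ge0 => l _; rewrite mulr_ge0 // ltW.
by rewrite mulr_gt0 // lt0r xj x0.
Qed.

Lemma continuous_coord (j : 'I_r.+1) :
  continuous (fun z : 'rV[R]_r.+1 * R => z.1 ord0 j).
Proof.
move=> z; apply: (@continuous_comp _ _ _ fst (fun v : 'rV[R]_r.+1 => v ord0 j)).
  exact: cvg_fst.
exact: coord_continuous.
Qed.

Lemma continuous_row_sum (c : 'I_r.+1 -> R) :
  continuous (fun z : 'rV[R]_r.+1 * R => \sum_j c j * z.1 ord0 j).
Proof.
move=> z; apply: cvg_big => [|j _]; first exact: add_continuous.
apply: cvgM; first exact: cvg_cst.
exact: continuous_coord.
Qed.

(** The pairs (x, mu) in which x lies in the standard simplex and T x >= mu x
    form a compact set; one with mu maximal is an eigenvector, since otherwise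
    T x would satisfy the strict inequality and mu could be increased. *)
Lemma perron_exists : exists p (l : R),
  (forall i, 0 < p i) /\ forall i, ap p i = l * p i.
Proof.
pose b := \sum_i \sum_j T i j.
pose K : set ('rV[R]_r.+1 * R) :=
  ([set v : 'rV[R]_r.+1 | forall i, `[0, 1]%classic (v ord0 i)] `*` `[0, b])%classic.
pose ok (z : 'rV[R]_r.+1 * R) := \sum_j 1 * z.1 ord0 j = 1 /\
  forall i, 0 <= ap (z.1 ord0) i - z.2 * z.1 ord0 i.
have cK : compact K.
  apply: compact_setX; last exact: segment_compact.
  by apply: (@rV_compact R r.+1 (fun=> `[0, 1]%classic)) => i; exact: segment_compact.
have c_ok : closed [set z | ok z]%classic.
  have -> : [set z | ok z]%classic =
      ((fun z : 'rV[R]_r.+1 * R => \sum_j 1 * z.1 ord0 j) @^-1` [set u | u = 1]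
      `&` \bigcap_(i in [set: 'I_r.+1])
       ((fun z : 'rV[R]_r.+1 * R => ap (z.1 ord0) i - z.2 * z.1 ord0 i)
          @^-1` [set u | 0 <= u]))%classic.
    apply/seteqP; split=> z /= [h1 h2]; split=> // i.
      by move=> _; exact: h2.
    exact: (h2 i I).
  apply: closedI.
    apply: preimage_closed; last exact: closed_eq.
    by move=> z _; exact: continuous_row_sum.
  apply: closed_bigI => i _; apply: preimage_closed; last exact: closed_ge.
  move=> z _; apply: cvgB; first exact: continuous_row_sum.
  apply: cvgM; first exact: cvg_snd.
  exact: continuous_coord.
pose S := (K `&` [set z | ok z])%classic.
have cS : compact S by apply: compact_closedI.
have bound x mu : (forall i, 0 <= x i) -> \sum_i x i = 1 ->
    (forall i, mu * x i <= ap x i) -> mu <= b.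
  move=> x0 x1 h; rewrite -(mulr1 mu) -x1 mulr_sumr.
  apply: (le_trans (ler_sum _ (fun i _ => h i))).
  apply: ler_sum => i _; apply: ler_sum => j _.
  rewrite -[leRHS]mulr1 ler_pM2l // -x1 (bigD1 j) //= lerDl sumr_ge0 //.
have S_intro x mu : 0 <= mu -> (forall i, 0 <= x i) -> \sum_i x i = 1 ->
    (forall i, mu * x i <= ap x i) -> S (\row_i x i, mu).
  move=> mu0 x0 x1 h; split; [split=> [i|] /=|split=> [|i] /=].
  - rewrite mxE in_itv /= x0 /= -x1 (bigD1 i) //= lerDl sumr_ge0 //.
  - by rewrite in_itv /= mu0 (bound x).
  - by rewrite -[RHS]x1; apply: eq_bigr => i _; rewrite mxE mul1r.
  - under eq_bigr do rewrite mxE.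
    by rewrite mxE subr_ge0.
have S0 : (S !=set0)%classic.
  exists (\row_i (fun=> r.+1%:R^-1) i, 0); apply: S_intro => //.
  - by rewrite sumr_const card_ord -[LHS]mulr_natl divff // pnatr_eq0.
  - by move=> i; rewrite mul0r sumr_ge0 // => j _; rewrite mulr_ge0 ?invr_ge0 // ltW.
have snd_cont : {within S, continuous snd}%classic.
  by apply: continuous_subspaceT => z; exact: cvg_snd.
have [[v l] /set_mem [[/= Kv Kl] [/= v1 vl]] lmax] := compact_EVT_max S0 cS snd_cont.
have v0 i : 0 <= v ord0 i by have := Kv i; rewrite in_itv => /andP[].
have l0 : 0 <= l by move: Kl; rewrite in_itv => /andP[].
pose y i := ap (v ord0) i.
have y0 : forall i, 0 < y i.
  apply: positive_image => //; apply/existsP; apply: contraTT isT => /existsPn h.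
  move: v1; rewrite big1 => [/esym/eqP|i _]; first by rewrite oner_eq0.
  by move/negPn/eqP: (h i) => ->; rewrite mulr0.
suff e i : y i = l * v ord0 i.
  exists y, l; split=> // i; rewrite mulr_sumr.
  by apply: eq_bigr => j _; rewrite e mulrCA.
apply/eqP; apply: contraT => yi.
pose z j := y j - l * v ord0 j.
have Tz : forall i, 0 < ap z i.
  by apply: positive_image => //; exists i; rewrite subr_eq0.
have TzE j : ap z j = ap y j - l * y j.
  rewrite /y mulr_sumr -sumrB; apply: eq_bigr => a _; rewrite mulrBr.
  by congr (_ - _); rewrite mulrCA.
have [i0 _ i0_min] := arg_minP (fun j => ap z j / y j) (erefl : predT ord0).
pose e := ap z i0 / y i0.
have e0 : 0 < e by rewrite divr_gt0.
pose s := \sum_j y j.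
have s0 : 0 < s by rewrite /s (bigD1 ord0) //= ltr_wpDr // sumr_ge0 // => j _; rewrite ltW.
have : S (\row_j (y j / s), l + e).
  apply: S_intro.
  - by rewrite addr_ge0 // ltW.
  - by move=> j; rewrite divr_ge0 // ltW.
  - by rewrite -mulr_suml divff // gt_eqF.
  - move=> j; under [leRHS]eq_bigr do rewrite mulrA.
    rewrite -mulr_suml mulrA ler_pM2r ?invr_gt0 // mulrDl -lerBrDl -TzE.
    by rewrite -ler_pdivlMr //; apply: i0_min.
by move=> /mem_set /lmax /=; rewrite gerDl leNgt e0.
Qed.

(** If w is an eigenvector for the same eigenvalue, subtract the largest
    multiple of p that leaves a nonnegative vector: the difference has a zero
    entry and would have a positive image if it were nonzero. *)
Lemma perron_unique (p : 'I_r.+1 -> R) (l : R) (w : 'I_r.+1 -> R) :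
  (forall i, 0 < p i) -> (forall i, ap p i = l * p i) ->
  (forall i, ap w i = l * w i) -> exists c, forall i, w i = c * p i.
Proof.
move=> p0 pl wl.
have [i0 _ i0_min] := arg_minP (fun j => w j / p j) (erefl : predT ord0).
pose c := w i0 / p i0; exists c => i.
pose z j := w j - c * p j.
have z0 j : 0 <= z j by rewrite subr_ge0 -ler_pdivlMr //; apply: i0_min.
have zi0 : z i0 = 0 by rewrite /z /c divfK ?subrr // gt_eqF.
apply/eqP; rewrite -subr_eq0; apply: contraT => zi.
have : 0 < ap z i0 by apply: positive_image => //; exists i.
suff -> : ap z i0 = l * z i0 by rewrite zi0 mulr0 ltxx.
rewrite mulrBr -wl mulrCA -pl mulr_sumr -sumrB.
by apply: eq_bigr => a _; rewrite mulrBr [c * (_ * _)]mulrCA.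
Qed.

End Perron.

(** * Graphs with an eigenvalue less than 2 *)

Section SubadditiveGraph.
Variables (R : realFieldType) (V : finType) (a : V -> V -> nat).
Hypothesis a_sym : forall x y, a x y = a y x.
Hypothesis a_irr : forall x, a x x = 0%N.
Variables (v : V -> R) (d : R).
Hypothesis v_gt0 : forall x, 0 < v x.
Hypothesis v_eig : forall x, \sum_y (a x y)%:R * v y = d * v x.
Hypothesis d_lt2 : d < 2.

Let adj x y := (0 < a x y)%N.

Let adj_sym x y : adj x y = adj y x. Proof. by rewrite /adj a_sym. Qed.

(** Pairing a weight w with the eigenvector v gives
    d <v, w> = <v, a w> >= 2 <v, w>, so d >= 2. *)
Lemma no_affine_subgraph n (h : nat -> V) (w : nat -> nat) :
  (forall i j, (i < n)%N -> (j < n)%N -> h i = h j -> i = j) ->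
  (exists2 i, (i < n)%N & (0 < w i)%N) ->
  (forall i, (i < n)%N -> exists T : seq nat,
     [/\ uniq T, forall l, l \in T -> (l < n)%N /\ adj (h i) (h l)
       & (2 * w i <= \sum_(l <- T) w l)%N]) ->
  False.
Proof.
move=> h_inj [i0 i0n wi0] hT.
pose H (i : 'I_n) := h i.
have H_inj : injective H.
  by move=> i j e; apply: val_inj; apply: h_inj; rewrite ?ltn_ord.
pose p := \sum_(i < n) (w i)%:R * v (H i).
have p_gt0 : 0 < p.
  rewrite /p (bigD1 (Ordinal i0n)) //= ltr_wpDr //.
    by apply: sumr_ge0 => i _; rewrite mulr_ge0 // ltW.
  by rewrite mulr_gt0 // ltr0n.
suff le2 : 2 * p <= d * p.
  by move: d_lt2; rewrite ltNge -(ler_pM2r p_gt0) le2.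
have weight (j : 'I_n) : (2 * w j <= \sum_(i < n) a (H j) (H i) * w i)%N.
  have [T [uT hl wT]] := hT j (ltn_ord j).
  apply: leq_trans wT _.
  have -> : \sum_(l <- T) w l = \sum_(i < n | (i : nat) \in T) w i.
    rewrite -(big_mkord (fun l => l \in T)) -big_filter.
    apply/perm_big/uniq_perm; rewrite ?filter_uniq ?iota_uniq // => l.
    rewrite mem_filter mem_index_iota; case lT: (l \in T) => //=.
    by have [] := hl l lT.
  rewrite big_mkcond /=; apply: leq_sum => i _; case: ifP => // iT.
  by have [_ a_gt0] := hl _ iT; rewrite leq_pmull.
rewrite /p !mulr_sumr.
have -> : \sum_(i < n) d * ((w i)%:R * v (H i))
        = \sum_(i < n) (w i)%:R * \sum_y (a (H i) y)%:R * v y.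
  by apply: eq_bigr => i _; rewrite v_eig mulrCA.
have step1 : \sum_(i < n) (w i)%:R * \sum_(j < n) (a (H i) (H j))%:R * v (H j)
          <= \sum_(i < n) (w i)%:R * \sum_y (a (H i) y)%:R * v y.
  apply: ler_sum => i _; apply: ler_wpM2l => //.
  rewrite -(big_imset (h := H) (A := predT) (fun y => (a (H i) y)%:R * v y)) /=.
    rewrite [leRHS](bigID (fun y => y \in [set H x | x in predT])) /= lerDl.
    by apply: sumr_ge0 => y _; rewrite mulr_ge0 // ltW.
  by move=> x y _ _; exact: H_inj.
apply: le_trans step1.
under [leRHS]eq_bigr do rewrite mulr_sumr.
rewrite [leRHS]exchange_big /=; apply: ler_sum => j _.
have -> : \sum_(i < n) (w i)%:R * ((a (H i) (H j))%:R * v (H j))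
        = (\sum_(i < n) a (H j) (H i) * w i)%:R * v (H j).
  rewrite natr_sum mulr_suml; apply: eq_bigr => i _.
  by rewrite natrM mulrA a_sym [(w i)%:R * _]mulrC.
by rewrite mulrA -natrM ler_pM2r // ler_nat.
Qed.

(** A multiple edge would be the affine diagram of rank 1, with marks 1. *)
Lemma simply_laced x y : (a x y <= 1)%N.
Proof.
rewrite leqNgt; apply/negP => axy.
have xy : x != y by apply: contraTneq axy => ->; rewrite a_irr.
have bound s t : (1 < a s t)%N -> 2 * v t <= d * v s.
  move=> ast; rewrite -v_eig (bigD1 t) //= ler_wpDr //.
    by apply: sumr_ge0 => z _; rewrite mulr_ge0 // ltW.
  by rewrite ler_pM2r // ler_nat.
have := lerD (bound x y axy) (bound y x _); rewrite a_sym => /(_ axy).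
rewrite -!mulrDr [v y + v x]addrC ler_pM2r ?addr_gt0 //.
by rewrite leNgt d_lt2.
Qed.

Lemma adjE x y : a x y = adj x y.
Proof. by rewrite /adj; case: (a x y) (simply_laced x y) => [|[]]. Qed.

Definition simple_path m (h : nat -> V) : Prop :=
  (forall i j, (i < m)%N -> (j < m)%N -> h i = h j -> i = j) /\
  (forall i, (i.+1 < m)%N -> adj (h i) (h i.+1)).

(** The weights of the affine diagrams of type A are all 1. *)
Lemma no_cycle m h : simple_path m h -> (3 <= m)%N -> ~~ adj (h m.-1) (h 0%N).
Proof.
move=> [h_inj h_adj] m3; apply/negP => chord.
apply: (@no_affine_subgraph m h (fun=> 1%N)) => //; first by exists 0%N => //; lia.
move=> i im; exists [:: (if i == 0%N then m.-1 else i.-1);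
                        (if i == m.-1 then 0%N else i.+1)]; split.
- by rewrite /= inE andbT; case: (i =P 0%N) => ?; case: (i =P m.-1) => ?; lia.
- move=> l; rewrite !inE => /orP[]/eqP->; case: eqP => i_eq; split; try lia.
  + by rewrite i_eq adj_sym.
  + rewrite adj_sym; have := h_adj i.-1; rewrite prednK; first by apply; lia.
    lia.
  + by rewrite i_eq.
  + by apply: h_adj; lia.
- by rewrite !big_cons big_nil.
Qed.

(** The affine diagram of type D with its marks, 1 on the four end vertices and
    2 on the others. For m = 3 it is a vertex with four neighbours. *)
Lemma no_two_branches m h y y' : simple_path m h -> (3 <= m)%N ->
  (forall i, (i < m)%N -> h i <> y) -> (forall i, (i < m)%N -> h i <> y') ->
  y <> y' -> adj (h 1%N) y -> adj (h m.-2) y' -> False.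
Proof.
move=> [h_inj h_adj] m3 hy hy' yy' ady ady'.
pose H t := if (t < m)%N then h t else if t == m then y else y'.
pose w t := if (0 < t < m.-1)%N then 2%N else 1%N.
have w_in t : (0 < t < m.-1)%N -> w t = 2%N by rewrite /w => ->.
have w_out t : ~~ (0 < t < m.-1)%N -> w t = 1%N by rewrite /w => /negbTE->.
have HE t : (t < m)%N -> H t = h t by rewrite /H => ->.
have Hm : H m = y by rewrite /H ltnn eqxx.
have Hm1 : H m.+1 = y' by rewrite /H ltnNge leqnSn /= gtn_eqF.
apply: (@no_affine_subgraph m.+2 H w).
- move=> i j im jm; rewrite /H.
  case: ltnP => im'; case: ltnP => jm'.
  + exact: h_inj.
  + by case: eqP => _ e; [case: (hy i)|case: (hy' i)].
  + by case: eqP => _ e; [case: (hy j)|case: (hy' j)].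
  + by do 2!case: eqP => ? //; try lia; move=> e; case: yy'.
- by exists 0%N.
have succ t : (t.+1 < m)%N -> adj (H t) (H t.+1).
  by move=> tm; rewrite !HE //; [apply: h_adj | lia].
have pred t : (0 < t < m)%N -> adj (H t) (H t.-1).
  move=> /andP[t0 tm]; rewrite adj_sym -{2}(prednK t0); apply: succ; lia.
move=> t tm.
have [t0|t0] := eqVneq t 0%N.
  exists [:: 1%N]; split=> // [l|].
    by rewrite inE => /eqP->; split; [lia | rewrite t0; apply: succ; lia].
  by rewrite big_seq1 t0 w_out ?w_in //; lia.
have [tm1|tm1] := eqVneq t m.-1.
  exists [:: m.-2]; split=> // [l|].
    rewrite inE => /eqP->; split; first lia.
    rewrite tm1; apply: pred; lia.
  by rewrite big_seq1 tm1 w_out ?w_in //; lia.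
have [tm2|tm2] := eqVneq t m.
  exists [:: 1%N]; split=> // [l|].
    rewrite inE => /eqP->; split; first lia.
    by rewrite tm2 Hm adj_sym HE //; lia.
  by rewrite big_seq1 tm2 w_out ?w_in //; lia.
have [tm3|tm3] := eqVneq t m.+1.
  exists [:: m.-2]; split=> // [l|].
    rewrite inE => /eqP->; split; first lia.
    by rewrite tm3 Hm1 adj_sym HE //; lia.
  by rewrite big_seq1 tm3 w_out ?w_in //; lia.
exists ([:: t.-1; t.+1] ++ (if t == 1%N then [:: m] else [::])
  ++ (if t == m.-2 then [:: m.+1] else [::])); split.
- by case: (t =P 1%N) => ?; case: (t =P m.-2) => ?; rewrite /= ?inE; lia.
- move=> l; rewrite !mem_cat !inE => /or3P[/orP[]/eqP->||].
  + by split; [lia | apply: pred; lia].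
  + by split; [lia | apply: succ; lia].
  + case: eqP => // t1; rewrite inE => /eqP->; split; first lia.
    by rewrite Hm t1 HE //; lia.
  + case: eqP => // t1; rewrite inE => /eqP->; split; first lia.
    by rewrite Hm1 t1 HE //; lia.
- have w_end s : (1 <= w s)%N by rewrite /w; case: ifP.
  rewrite (w_in t); last lia.
  have := w_end t.-1; have := w_end t.+1; have := w_end m; have := w_end m.+1.
  case: (t =P 1%N) => t1; case: (t =P m.-2) => t2; rewrite /= !big_cons big_nil.
  + by lia.
  + rewrite (w_in t.+1); last lia.
    by lia.
  + rewrite (w_in t.-1); last lia.
    by lia.
  + rewrite (w_in t.-1); last lia.
    rewrite (w_in t.+1); last lia.
    by lia.
Qed.

(** The weights W of the tree with edges E satisfy the inequality that makes it
    an obstruction; for given W and E this is decided by computation. *)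
Definition affine_weights (W : seq nat) (E : seq (nat * nat)) : bool :=
  all (fun i => let T := [seq l <- iota 0 (size W) | ((i, l) \in E) || ((l, i) \in E)]
       in 2 * nth 0 W i <= sumn [seq nth 0 W l | l <- T])%N (iota 0 (size W)).

Lemma no_affine_tree (W : seq nat) (E : seq (nat * nat)) (s : seq V) x0 :
  affine_weights W E -> (0 < head 0 W)%N -> uniq s -> size s = size W ->
  all (fun p => adj (nth x0 s p.1) (nth x0 s p.2)) E -> False.
Proof.
move=> /allP okW W0 us sW /allP adjE'.
have sW0 : (0 < size W)%N by case: (W) W0.
apply: (@no_affine_subgraph (size W) (nth x0 s) (nth 0%N W)).
- by move=> i j im jm /eqP; rewrite nth_uniq ?sW // => /eqP.
- by exists 0%N; rewrite ?nth0.
move=> i im.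
exists [seq l <- iota 0 (size W) | ((i, l) \in E) || ((l, i) \in E)]; split.
- by rewrite filter_uniq ?iota_uniq.
- move=> l; rewrite mem_filter mem_iota add0n => /andP[il lm]; split=> //.
  by case/orP: il => /adjE' /=; rewrite 1?adj_sym.
- rewrite -[X in (_ <= X)%N](big_map (nth 0%N W) predT id) -sumnE.
  by apply: okW; rewrite mem_iota add0n.
Qed.

Definition path_edges m : seq (nat * nat) := [seq (t, t.+1) | t <- iota 0 m.-1].

Lemma simple_path_uniq m h : simple_path m h -> uniq (mkseq h m).
Proof.
move=> [h_inj _]; rewrite map_inj_in_uniq ?iota_uniq // => i j.
by rewrite !mem_iota !add0n; exact: h_inj.
Qed.

Lemma mkseq_notin m (h : nat -> V) y : (forall i, (i < m)%N -> h i <> y) ->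
  y \notin mkseq h m.
Proof.
by move=> hy; apply/mapP => -[t]; rewrite mem_iota add0n => tm /esym; exact: hy.
Qed.

Lemma simple_path_edges x0 s m h : simple_path m h ->
  all (fun p => adj (nth x0 (mkseq h m ++ s) p.1) (nth x0 (mkseq h m ++ s) p.2))
      (path_edges m).
Proof.
move=> [_ h_adj]; apply/allP => _ /mapP[t tm ->] /=.
move: tm; rewrite mem_iota add0n => tm.
by rewrite !nth_cat size_mkseq !ifT ?nth_mkseq; first (by apply: h_adj; lia); lia.
Qed.

Lemma no_long_branch m h y b W : simple_path m h ->
  (forall i, (i < m)%N -> h i <> y) -> (b < m)%N -> adj (h b) y ->
  (0 < head 0 W)%N -> size W = m.+1 ->
  ~~ affine_weights W (rcons (path_edges m) (b, m)).
Proof.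
move=> hp hy bm ady W0 sW; apply/negP => okW.
apply: (@no_affine_tree _ _ (mkseq h m ++ [:: y]) y okW W0).
- rewrite cat_uniq (simple_path_uniq hp) /= orbF andbT.
  exact: mkseq_notin.
- by rewrite size_cat size_mkseq addn1.
- rewrite all_rcons simple_path_edges // andbT /=.
  by rewrite !nth_cat size_mkseq bm ltnn subnn nth_mkseq.
Qed.

(** The affine diagram of type E7 with its marks, the last one on y. *)
Lemma no_E7 h y : simple_path 7 h -> (forall i, (i < 7)%N -> h i <> y) ->
  ~~ adj (h 3%N) y.
Proof.
move=> hp hy; apply/negP => ady.
by have := @no_long_branch 7 h y 3 [:: 1; 2; 3; 4; 3; 2; 1; 2]%N hp hy isT ady isT erefl.
Qed.

(** The affine diagram of type E8 with its marks, the last one on y. *)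
Lemma no_E8 h y : simple_path 8 h -> (forall i, (i < 8)%N -> h i <> y) ->
  ~~ adj (h 2%N) y.
Proof.
move=> hp hy; apply/negP => ady.
by have := @no_long_branch 8 h y 2 [:: 2; 4; 6; 5; 4; 3; 2; 1; 3]%N hp hy isT ady isT erefl.
Qed.

(** The affine diagram of type E6 with its marks, the last two on y and z. *)
Lemma no_E6 h y z : simple_path 5 h -> (forall i, (i < 5)%N -> h i <> y) ->
  (forall i, (i < 5)%N -> h i <> z) -> y <> z -> adj (h 2%N) y -> ~~ adj y z.
Proof.
move=> hp hy hz yz ady; apply/negP => adz.
apply: (@no_affine_tree [:: 1; 2; 3; 2; 1; 2; 1]%N (path_edges 5 ++ [:: (2, 5); (5, 6)]%N)
  (mkseq h 5 ++ [:: y; z]) y) => //.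
- rewrite cat_uniq (simple_path_uniq hp) -[uniq [:: y; z]]/(_ && true).
  rewrite -[has _ _]/[|| _, _ | false] (negPf (mkseq_notin hy)).
  by rewrite (negPf (mkseq_notin hz)) inE andbT; apply/eqP.
- by rewrite all_cat simple_path_edges //= ady adz.
Qed.

Lemma simple_path_sub m g i m' : simple_path m g -> (i + m' <= m)%N ->
  simple_path m' (fun t => g (i + t)%N).
Proof.
move=> [g_inj g_adj] im; split=> [s t sm tm e|t tm].
  by apply/(@addnI i)/g_inj; rewrite ?e //; lia.
by rewrite addnS; apply: g_adj; lia.
Qed.

Lemma simple_path_rev m g :
  simple_path m g -> simple_path m (fun t => g (m.-1 - t)%N).
Proof.
move=> [g_inj g_adj]; split=> [s t sm tm e|t tm].
  have : (m.-1 - s = m.-1 - t)%N by apply: g_inj => //; lia.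
  lia.
rewrite adj_sym; have -> : (m.-1 - t = (m.-1 - t.+1).+1)%N by lia.
by apply: g_adj; lia.
Qed.

Lemma simple_path_cons m g x : simple_path m g ->
  (forall i, (i < m)%N -> g i <> x) -> ((0 < m)%N -> adj x (g 0%N)) ->
  simple_path m.+1 (fun t => if t is t'.+1 then g t' else x).
Proof.
move=> [g_inj g_adj] gx adx; split=> [[|s] [|t] // sm tm e|[|t] tm].
- by case: (gx t).
- by case: (gx s).
- by congr _.+1; apply: g_inj.
- exact: adx.
- exact: g_adj.
Qed.

(** A chord would close a cycle. *)
Lemma path_adj m g i j : simple_path m g -> (i < m)%N -> (j < m)%N ->
  a (g i) (g j) = (j == i.+1) || (i == j.+1).
Proof.
move=> gp im jm; wlog ij : i j im jm / (i <= j)%N.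
  move=> W; case: (leqP i j) => [|/ltnW] ij; first exact: W.
  by rewrite a_sym orbC W.
have [->|ij'] := eqVneq i j; first by rewrite a_irr orbb ltn_eqF.
rewrite adjE; have [->|ij''] := eqVneq j i.+1.
  by case: gp => _ -> //; lia.
have gp' := @simple_path_sub _ _ i (j - i).+1 gp ltac:(lia).
have := no_cycle gp' ltac:(lia).
rewrite /= addn0 subnKC // adj_sym => /negbTE->.
by case: eqP => //; lia.
Qed.

(** A second neighbour of y on the path would close a cycle through y. *)
Lemma branch_adj m g y b i : simple_path m g ->
  (forall j, (j < m)%N -> g j <> y) -> (b < m)%N -> adj (g b) y -> (i < m)%N ->
  a (g i) y = (i == b).
Proof.
move=> gp gy bm adb im; rewrite adjE; have [->|ne] := eqVneq i b; first by rewrite adb.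
apply/eqP; rewrite eqb0; apply/negP => ady.
wlog ib : i b im bm adb ady ne / (i < b)%N.
  move=> W; case: (ltngtP i b) => ib; first exact: (W i b).
    by apply: (W b i) => //; rewrite eq_sym.
  by rewrite ib eqxx in ne.
have gp' := @simple_path_sub _ _ i (b - i).+1 gp ltac:(lia).
have gp'' : simple_path (b - i).+2 (fun t => if t is t'.+1 then g (i + t')%N else y).
  apply: (@simple_path_cons _ _ y gp') => [t tm|_]; first by apply: gy; lia.
  by rewrite addn0 adj_sym.
by have := no_cycle gp'' ltac:(lia); rewrite /= subnKC ?adb; last lia.
Qed.

Definition is_dynkin_image (t : dynkin) (f : 'I_(dyn_rank t) -> V) : Prop :=
  injective f /\ forall i j, a (f i) (f j) = dyn_adj t i j.

Definition branched_dynkin m (g : nat -> V) y : Prop :=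
  exists t (f : 'I_(dyn_rank t) -> V), is_dynkin_image f /\
    forall x, (exists j, f j = x) <-> x = y \/ exists2 j, (j < m)%N & g j = x.

Lemma branched_dynkin_rev m g y :
  branched_dynkin m (fun t => g (m.-1 - t)%N) y -> branched_dynkin m g y.
Proof.
move=> [t [f [tf fP]]]; exists t, f; split=> // x; rewrite fP.
split=> -[->|[j jm <-]]; try (by left); right;
  exists (m.-1 - j)%N; [lia | by [] | lia | by congr g; lia].
Qed.

(** The vertices of the path are numbered so that the branching vertex has the
    position that the diagrams of types D and E give to it. *)
Lemma branch_dynkin_oriented m g y b : simple_path m g ->
  (forall j, (j < m)%N -> g j <> y) -> adj (g b) y -> (0 < b)%N -> (b.+1 < m)%N ->
  m = b.+2 \/ b = 2%N /\ (m <= 7)%N ->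
  branched_dynkin m g y.
Proof.
move=> gp gy adb b0 bm shape.
have [t [rk ed]] : exists t, dyn_rank t = m.+1 /\
    forall i j, dyn_edge t i j = branch_edge m.+1 b i j.
  case: shape => [mb|[b2 m7]].
    have m3 : (4 <= m.+1)%N by lia.
    by exists (DynD m3); split=> //= i j; congr branch_edge; lia.
  have [m4|[m5|[m6|m7']]] : (m = 4 \/ m = 5 \/ m = 6 \/ m = 7)%N by lia.
  - by exists (@DynD 5 isT); rewrite b2 m4.
  - by exists DynE6; rewrite b2 m5.
  - by exists DynE7; rewrite b2 m6.
  - by exists DynE8; rewrite b2 m7'.
exists t, (fun j => if (j < m)%N then g j else y); split; last first.
  move=> x; split=> [[j <-]|[->|[j jm <-]]].
  - by case: ifP => jm; [right; exists j | left].
  - have mt : (m < dyn_rank t)%N by rewrite rk.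
    by exists (Ordinal mt); rewrite /= ltnn.
  - have jt : (j < dyn_rank t)%N by rewrite rk; lia.
    by exists (Ordinal jt); rewrite /= jm.
have rkP (j : 'I_(dyn_rank t)) : (j <= m)%N.
  by have := ltn_ord j; rewrite {2}rk.
split=> [i j|i j].
  have [g_inj _] := gp; have := rkP i; have := rkP j.
  case: ifP => im; case: ifP => jm jm' im' e; apply: val_inj => /=.
  - exact: g_inj.
  - by case: (gy i im).
  - by case: (gy j jm).
  - by lia.
rewrite /dyn_adj !ed /branch_edge /=; have := rkP i; have := rkP j.
case: ifP => im; case: ifP => jm jm' im'.
- by rewrite (path_adj gp) //; congr nat_of_bool; lia.
- by rewrite (branch_adj gp gy _ adb) //; [congr nat_of_bool|]; lia.
- by rewrite a_sym (branch_adj gp gy _ adb) //; [congr nat_of_bool|]; lia.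
- by rewrite a_irr; symmetry; apply/eqP; rewrite eqb0; lia.
Qed.

(** Two arms of length at least 3 would give the affine diagram of type E7, and
    arms of lengths 2 and at least 5 that of type E8. *)
Lemma branch_dynkin m g y b : simple_path m g ->
  (forall j, (j < m)%N -> g j <> y) -> adj (g b) y -> (0 < b)%N -> (b.+1 < m)%N ->
  branched_dynkin m g y.
Proof.
move=> gp gy adb b0 bm.
(* reversing the path, the initial arm is the shorter one *)
wlog short : g b gp gy adb b0 bm / (b <= m.-1 - b)%N.
  move=> W; case: (leqP b (m.-1 - b)) => ord; first exact: (W g b).
  apply: branched_dynkin_rev; apply: (W _ (m.-1 - b)%N (simple_path_rev gp)).
  - by move=> j jm; apply: gy; lia.
  - by have -> : (m.-1 - (m.-1 - b) = b)%N by lia.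
  - by lia.
  - by lia.
  - by lia.
(* in type D the branching vertex is numbered from the long arm *)
have [b1|b1] := eqVneq b 1%N.
  apply: branched_dynkin_rev.
  apply: (branch_dynkin_oriented (b := (m.-1 - b)%N) (simple_path_rev gp)).
  - by move=> j jm; apply: gy; lia.
  - by have -> : (m.-1 - (m.-1 - b) = b)%N by lia.
  - by lia.
  - by lia.
  - by left; lia.
apply: (branch_dynkin_oriented gp gy adb b0 bm); right.
have b2 : b = 2%N.
  apply: contraTeq isT => b2.
  have gp' := @simple_path_sub _ _ (b - 3) 7 gp ltac:(lia).
  have hy i : (i < 7)%N -> g (b - 3 + i)%N <> y by move=> i7; apply: gy; lia.
  by have := no_E7 gp' hy; rewrite subnK ?adb //; lia.
split=> //; rewrite leqNgt; apply/negP => m8.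
have gp' := @simple_path_sub _ _ 0 8 gp ltac:(lia).
have hy i : (i < 8)%N -> g (0 + i)%N <> y by move=> i8; apply: gy; lia.
by have := no_E8 gp' hy; rewrite add0n -b2 adb.
Qed.

Section Component.
Variable x0 : V.
Let comp y := connect adj x0 y.

Lemma comp_adj y z : comp y -> adj y z -> comp z.
Proof. by move=> cy yz; apply: connect_trans cy (connect1 yz). Qed.

Lemma comp_path m g i : simple_path m g -> comp (g 0%N) -> (i < m)%N -> comp (g i).
Proof.
move=> [_ g_adj] g0; elim: i => // i IH im.
by apply: comp_adj (g_adj _ im); apply: IH; lia.
Qed.

Lemma longest_path : exists m g, [/\ (0 < m)%N, simple_path m g, comp (g 0%N)
  & forall m' g', simple_path m' g' -> comp (g' 0%N) -> (m' <= m)%N].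
Proof.
pose P m := `[< exists g, simple_path m g /\ comp (g 0%N) >].
have P1 : P 1%N.
  apply/asboolP; exists (fun=> x0); split; last exact: connect0.
  by split=> // i j; lia.
have [||m /asboolP[g [gp g0]] m_max] := @ex_maxnP P #|V|; first by exists 1%N.
  move=> m /asboolP[g [gp _]].
  by rewrite -(size_mkseq g m) -(card_uniqP (simple_path_uniq gp)) max_card.
exists m, g; split=> //; first exact: m_max.
by move=> m' g' gp' g0'; apply: m_max; apply/asboolP; exists g'.
Qed.

(** By maximality a vertex outside a longest path is adjacent only to its inner
    vertices, so two such vertices would give an affine diagram of type D. If
    there is just one, any further neighbour of it would start an arm of length
    2, and maximality would make the two other arms at least as long: this is
    the affine diagram of type E6. Hence the component is a path with at most
    one extra vertex. *)
Lemma component_dynkin : exists t (f : 'I_(dyn_rank t) -> V),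
  is_dynkin_image f /\ forall x, comp x <-> exists j, f j = x.
Proof.
have [m [g [m0 gp g0 m_max]]] := longest_path.
have close t (f : 'I_(dyn_rank t) -> V) : is_dynkin_image f ->
    (exists j, f j = g 0%N) -> (forall j, comp (f j)) ->
    (forall j x, adj (f j) x -> exists l, f l = x) ->
    exists t (f : 'I_(dyn_rank t) -> V),
      is_dynkin_image f /\ forall x, comp x <-> exists j, f j = x.
  move=> tf f0 fc f_adj; exists t, f; split=> // x; split=> [cx|[j <-]//].
  have : connect adj (g 0%N) x.
    by apply: connect_trans cx; rewrite sym_connect_sym.
  case/connectP => p; elim: p (g 0%N) f0 => [z [j fz] _ -> | z p IH u [j fj] /=].
    by exists j.
  case/andP=> uz zp xp; apply: (IH z) => //; apply: (f_adj j); by rewrite fj.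
have inner y b : (forall j, (j < m)%N -> g j <> y) -> (b < m)%N -> adj (g b) y ->
    (0 < b)%N /\ (b.+1 < m)%N.
  move=> gy bm ady; have cy : comp y by exact: (comp_adj (comp_path gp g0 bm) ady).
  have ext h : simple_path m h -> (forall j, (j < m)%N -> h j <> y) ->
      ~ adj y (h 0%N).
    by move=> hp hy yh; have := m_max _ _ (simple_path_cons hp hy (fun=> yh)) cy; lia.
  split; rewrite ltnNge; apply/negP => b0.
    have b0' : b = 0%N by lia.
    by apply: (ext g) => //; rewrite adj_sym -b0'.
  apply: (ext _ (simple_path_rev gp)) => [j jm|]; first by apply: gy; lia.
  by rewrite subn0 adj_sym; have -> : m.-1 = b by lia.
have [[y [b [gy bm ady]]]|none] := pselect (exists y b,
  [/\ forall j, (j < m)%N -> g j <> y, (b < m)%N & adj (g b) y]); last first.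
  apply: (close (DynA m0) (fun j : 'I_m => g j)).
  - split=> [i j e|i j]; last by rewrite (path_adj gp) ?ltn_ord.
    by have [g_inj _] := gp; apply: val_inj; apply: g_inj; rewrite ?ltn_ord.
  - by exists (Ordinal m0).
  - by move=> j; apply: (comp_path gp g0); rewrite ltn_ord.
  move=> j x jx; apply: contrapT => nx; apply: none; exists x, j; split=> //.
  by move=> l lm glx; apply: nx; exists (Ordinal lm).
have [b0 bm1] := inner _ _ gy bm ady.
have [t [f [tf fP]]] := branch_dynkin gp gy ady b0 bm1.
have cy : comp y by exact: (comp_adj (comp_path gp g0 bm) ady).
apply: (close t f tf).
- by apply/fP; right; exists 0%N.
- by move=> j; have /fP[->//|[l lm <-]] : exists l, f l = f j; [exists j|exact: (comp_path gp g0)].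
move=> j x jx; apply/fP; apply: contrapT => /not_orP[xy /forall2NP gx'].
have gx l : (l < m)%N -> g l <> x by move=> lm e; case: (gx' l); apply.
have /fP[jy|[l lm gl]] : exists l, f l = f j by exists j.
  (* the neighbour x of y starts a third arm of length 2: affine type E6 *)
  rewrite jy in jx; have yx : y <> x by move=> e; apply: xy.
  have cx : comp x := comp_adj cy jx.
  have arm h c : simple_path m h -> (forall i, (i < m)%N -> h i <> y) ->
      (forall i, (i < m)%N -> h i <> x) -> (c < m)%N -> adj (h c) y -> (2 <= c)%N.
    move=> hp hy hx cm ady'.
    have hp1 : simple_path (m - c).+1 (fun t => if t is t'.+1 then h (c + t')%N else y).
      apply: simple_path_cons => [|i im|_]; first by apply: simple_path_sub hp _; lia.
        by apply: hy; lia.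
      by rewrite addn0 adj_sym.
    have hp2 : simple_path (m - c).+2 (fun t => if t is t1.+1 then
        (if t1 is t2.+1 then h (c + t2)%N else y) else x).
      apply: (simple_path_cons hp1) => [[|i] im //|_]; last by rewrite adj_sym.
      by apply: hx; lia.
    by have := m_max _ _ hp2 cx; lia.
  have b2 : (2 <= b)%N by apply: (arm g).
  have b3 : (2 <= m.-1 - b)%N.
    apply: (arm _ _ (simple_path_rev gp)) => [i im|i im||]; rewrite ?subKn //; try lia.
    - by apply: gy; lia.
    - by apply: gx; lia.
  have hp : simple_path 5 (fun t => g (b - 2 + t)%N).
    by apply: simple_path_sub gp _; lia.
  have := no_E6 hp _ _ yx; rewrite subnK // jx => W.
  have : false by apply: W => // i i5; [apply: gy | apply: gx]; lia.
  by [].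
(* two branching vertices on the path, or one with four neighbours: affine
   type D *)
rewrite -gl in jx; have [l0 lm1] := inner _ _ gx lm jx.
have yx : y <> x by move=> e; apply: xy.
have two z z' c c' : (forall i, (i < m)%N -> g i <> z) ->
    (forall i, (i < m)%N -> g i <> z') -> z <> z' -> adj (g c) z -> adj (g c') z' ->
    (0 < c)%N -> (c <= c')%N -> (c'.+1 < m)%N -> False.
  move=> gz gz' zz' adz adz' c0 cc' cm.
  have hp : simple_path (c' - c).+3 (fun t => g (c.-1 + t)%N).
    by apply: simple_path_sub gp _; lia.
  apply: (no_two_branches hp _ _ _ zz') => // [i im|i im||].
  - by apply: gz; lia.
  - by apply: gz'; lia.
  - by rewrite addn1 prednK.
  - by rewrite /=; have -> : (c.-1 + (c' - c).+1 = c')%N by lia.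
by case: (leqP b l) => [|/ltnW] bl;
  [apply: (two y x b l) | apply: (two x y l b)] => // e; apply: yx.
Qed.
End Component.

End SubadditiveGraph.

(** * Positive eigenvectors of the Dynkin diagrams *)

Section AdjacencySums.
Variables (R : nzRingType) (u : nat -> R).

Lemma sum_at n l : \sum_(j < n) (j == l :> nat)%:R * u j = if (l < n)%N then u l else 0.
Proof.
case: ltnP => ln.
  rewrite (bigD1 (Ordinal ln)) //= eqxx mul1r big1 ?addr0 // => j.
  by rewrite -val_eqE /= => /negbTE->; rewrite mul0r.
rewrite big1 // => j _; rewrite [_ == l]ltn_eqF ?mul0r //.
exact: leq_trans (ltn_ord j) ln.
Qed.

Lemma path_sum n i : \sum_(j < n) ((j == i.+1 :> nat) || (i == j.+1))%:R * u j =
  (if (i.+1 < n)%N then u i.+1 else 0) + (if (0 < i <= n)%N then u i.-1 else 0).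
Proof.
rewrite -sum_at.
have -> : (if (0 < i <= n)%N then u i.-1 else 0)
        = \sum_(j < n) (i == j.+1)%:R * u j.
  case: i => [|i] /=; last by rewrite -sum_at; apply: eq_bigr => j _; rewrite eqSS eq_sym.
  by rewrite big1 // => j _; rewrite mul0r.
rewrite -big_split /=; apply: eq_bigr => j _; rewrite -mulrDl -natrD.
by congr (_%:R * _); case: eqP => // ->; case: eqP => //; lia.
Qed.

Lemma branch_sum m b i : (b < m)%N -> (i <= m)%N ->
  \sum_(j < m.+1) (branch_edge m.+1 b i j || branch_edge m.+1 b j i)%:R * u j =
  if i == m then u b else
  (if (i.+1 < m)%N then u i.+1 else 0) + (if (0 < i)%N then u i.-1 else 0)
    + (if i == b then u m else 0).
Proof.
move=> bm im; rewrite big_ord_recr /=.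
have [->|ne] := eqVneq i m.
  rewrite -[RHS]addr0; congr (_ + _); last first.
    have -> : branch_edge m.+1 b m m = false by rewrite /branch_edge /=; lia.
    by rewrite mul0r.
  transitivity (if (b < m)%N then u b else 0); last by rewrite bm.
  rewrite -sum_at.
  apply: eq_bigr => j _; congr (_%:R * _); congr nat_of_bool.
  by rewrite /branch_edge /=; have := ltn_ord j; lia.
congr (_ + _).
  transitivity (\sum_(j < m) ((j == i.+1 :> nat) || (i == j.+1))%:R * u j).
    apply: eq_bigr => j _; congr (_%:R * _); congr nat_of_bool.
    by rewrite /branch_edge /=; have := ltn_ord j; lia.
  by rewrite path_sum im andbT.
have -> : branch_edge m.+1 b i m || branch_edge m.+1 b m i = (i == b).
  by rewrite /branch_edge /=; lia.
by case: (i == b); rewrite ?mul1r ?mul0r.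
Qed.

End AdjacencySums.

Section PositiveEigenvector.
Variables (R : realType) (h : nat).
Hypothesis h_ge2 : (2 <= h)%N.

Local Notation theta := (pi / h%:R : R).
Local Notation S k := (sin (k%:R * theta)).

Lemma sin_mul_gt0 k : (0 < k < h)%N -> 0 < S k.
Proof.
move=> /andP[k0 kh]; apply: sin_gt0_pi.
have h0 : 0 < h%:R :> R by rewrite ltr0n; lia.
apply/andP; split; first by apply: mulr_gt0; [rewrite ltr0n | apply: divr_gt0; rewrite ?pi_gt0].
by rewrite mulrCA gtr_pMr ?pi_gt0 // ltr_pdivrMr // mul1r ltr_nat.
Qed.

Lemma sin_mul_rec k : S k.+2 + S k = 2 * cos theta * S k.+1.
Proof.
have -> : k.+2%:R * theta = k.+1%:R * theta + theta by rewrite [in LHS]mulrS; ring.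
have -> : k%:R * theta = k.+1%:R * theta - theta by rewrite [in RHS]mulrS; ring.
by rewrite sinD sinB; ring.
Qed.

Lemma sin_mul0 : S 0%N = 0. Proof. by rewrite mul0r sin0. Qed.

Lemma sin_mul_symm k l : (k + l = h)%N -> S k = S l.
Proof.
move=> kl; have -> : k%:R * theta = pi - l%:R * theta.
  have -> : k%:R = h%:R - l%:R :> R by rewrite -kl natrD addrK.
  by rewrite mulrBl mulrCA divff ?mulr1 // pnatr_eq0; lia.
by rewrite sinB sinpi cospi mul0r sub0r mulN1r opprK.
Qed.

End PositiveEigenvector.

Definition positive_eigenvector (R : realType) (t : dynkin) (l : R) (u : nat -> R) :=
  (forall i, (i < dyn_rank t)%N -> 0 < u i) /\
  forall i, (i < dyn_rank t)%N ->
    \sum_(j < dyn_rank t) (dyn_adj t i j)%:R * u j = l * u i.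

Section Eigenvectors.
Variable R : realType.

Local Notation lam h := (2 * cos (pi / h%:R : R)).

(** The vector is the restriction to 0 < k < h of the function sin (k pi / h),
    which vanishes at 0 and at h. *)
Lemma eigenvector_A n (n1 : (1 <= n)%N) :
  exists u, positive_eigenvector (DynA n1) (lam n.+1) u.
Proof.
have h2 : (2 <= n.+1)%N by [].
exists (fun j => sin (j.+1%:R * (pi / n.+1%:R))); split=> [i|i] /= im.
  exact: sin_mul_gt0.
rewrite /dyn_adj /= (path_sum (fun j => sin (j.+1%:R * (pi / n.+1%:R)))).
rewrite -(sin_mul_rec R n.+1 i) (ltnW im) andbT.
congr (_ + _); last by case: (i) => [|i'] //=; rewrite sin_mul0.
case: ltnP => // ni; have -> : i.+2 = n.+1 by lia.
by rewrite (@sin_mul_symm _ _ h2 n.+1 0) ?addn0 // sin_mul0.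
Qed.

(** The vector is twice the sine on the long arm, and the value of the sine at
    pi / 2 on the two short ones: the symmetry of the sine about pi / 2 gives
    the equation at the two short ends. *)
Lemma eigenvector_D n (n4 : (4 <= n)%N) :
  exists u, positive_eigenvector (DynD n4) (lam (2 * n.-1)) u.
Proof.
case: n n4 => // m m3; have {}m3' : (3 <= m)%N by [].
have h2 : (2 <= 2 * m.+1.-1)%N by lia.
set h := (2 * m.+1.-1)%N in h2 *.
pose S k : R := sin (k%:R * (pi / h%:R)).
have rec k : S k.+2 + S k = lam h * S k.+1 := sin_mul_rec R h k.
have gt0 k : (0 < k < h)%N -> 0 < S k := @sin_mul_gt0 R h h2 k.
have sym k l : (k + l = h)%N -> S k = S l := @sin_mul_symm R h h2 k l.
pose u j := if (j < m.-1)%N then 2 * S j.+1 else S m.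
exists u; split=> [i|i] /= im.
  by rewrite /u; case: ifP => im'; [rewrite mulr_gt0 ?gt0 //|apply: gt0]; rewrite /h; lia.
have u_in j : (j < m.-1)%N -> u j = 2 * S j.+1 by rewrite /u => ->.
have u_out j : (m.-1 <= j)%N -> u j = S m by rewrite /u ltnNge => ->.
have top : lam h * S m = 2 * S m.-1.
  rewrite -[in S m](prednK (n := m)); last lia.
  rewrite -rec prednK; last lia.
  by rewrite (sym m.+1 m.-1) ?mulr2n ?mulrDl ?mul1r //; rewrite /h; lia.
have be : (m.+1 - 3 = m.-2)%N by lia.
rewrite /dyn_adj /= be branch_sum; [|lia|lia].
have [->|ne] := eqVneq i m.
  by rewrite (u_out m) ?u_in; [rewrite top; congr (_ * S _); lia|lia|lia].
have [->|ne'] := eqVneq i m.-1.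
  rewrite ifF; last lia.
  rewrite ifT; last lia.
  rewrite ifF; last lia.
  rewrite (u_out m.-1) // u_in; last lia.
  by rewrite top add0r addr0; congr (_ * S _); lia.
rewrite (u_in i); last lia.
rewrite mulrCA -rec mulrDr ifT; last lia.
rewrite addrAC; congr (_ + _).
  have [i_eq|ne''] := eqVneq i m.-2.
    rewrite !u_out; try lia.
    have -> : i.+2 = m by lia.
    by rewrite mulr2n mulrDl mul1r.
  by rewrite addr0 u_in //; lia.
case: (posnP i) => [->|i0]; first by rewrite /S sin_mul0 mulr0.
by rewrite u_in ?prednK //; lia.
Qed.

(** The cosine of a right angle, the triple of pi / 6, is
    4 cos^3 (pi / 6) - 3 cos (pi / 6), and it vanishes. *)
Lemma cos_pi6 : 4 * cos (pi / 6%:R : R) ^+ 2 = 3.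
Proof.
pose x := pi / 6%:R : R.
have x3 : pi / 2 = x + x + x by rewrite /x; field.
have c0 : 0 < cos x.
  have p0 := pi_gt0 R; apply: cos_gt0_pihalf; rewrite x3 /x; lra.
have : cos x * (4 * cos x ^+ 2 - 3) = 0.
  rewrite -(cos_pihalf R) x3 !cosD !sinD.
  have := sin2cos2 x; rewrite !expr2 => s2.
  have -> : (cos x * cos x - sin x * sin x) * cos x - (sin x * cos x + cos x * sin x) * sin x
     = cos x * (cos x * cos x - 3 * (sin x * sin x)) by ring.
  by rewrite s2; ring.
by move/eqP; rewrite mulf_eq0 gt_eqF //= subr_eq0 => /eqP.
Qed.

(** In type E with arms of lengths 1, 2 and m - 3 the vector is given on each
    arm by the sines of the multiples of pi / h, normalized to be 1 at the
    branching vertex; only the equation at that vertex constrains h. *)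
Lemma eigenvector_E m h : (5 <= m)%N -> (m - 2 < h)%N ->
  let S k : R := sin (k%:R * (pi / h%:R)) in
  S 1%N / S 2%N + S 2%N / S 3%N + S (m - 3)%N / S (m - 2)%N = lam h ->
  exists u, (forall i, (i <= m)%N -> 0 < u i) /\ forall i, (i <= m)%N ->
   \sum_(j < m.+1) (branch_edge m.+1 2 i j || branch_edge m.+1 2 j i)%:R * u j
     = lam h * u i.
Proof.
move=> m5 mh S center; have h2 : (2 <= h)%N by lia.
have rec k : S k.+2 + S k = lam h * S k.+1 := sin_mul_rec R h k.
have gt0 k : (0 < k < h)%N -> 0 < S k := @sin_mul_gt0 R h h2 k.
have S0 : S 0%N = 0 := sin_mul0 R h.
pose u j := if j == m then S 1%N / S 2%N else
  if (j < 2)%N then S j.+1 / S 3%N else S (m - j)%N / S (m - 2)%N.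
have um : u m = S 1%N / S 2%N by rewrite /u eqxx.
have u_left j : (j < 2)%N -> u j = S j.+1 / S 3%N.
  by move=> j2; rewrite /u j2 ifF //; lia.
have u_right j : (2 <= j < m)%N -> u j = S (m - j)%N / S (m - 2)%N.
  by move=> /andP[j2 jm]; rewrite /u ltnNge j2 ifF //; lia.
have u2 : u 2%N = 1 by rewrite u_right ?divff ?gt_eqF ?gt0 //; lia.
exists u; split=> i im.
  rewrite /u; case: eqP => ?; first by rewrite divr_gt0 ?gt0 //; lia.
  by case: ifP => ?; rewrite divr_gt0 ?gt0 //; lia.
have S2 : S 2%N = lam h * S 1%N by rewrite -rec S0 addr0.
rewrite branch_sum //; last lia.
have [->|ne] := eqVneq i m.
  by rewrite u2 um mulrA -S2 divff // gt_eqF // gt0 //; lia.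
have [->|ne2] := eqVneq i 2%N.
  rewrite ifT; last lia.
  rewrite /= u2 mulr1 -center um (u_left 1%N) // (u_right 3%N) /=; last lia.
  by ring.
rewrite addr0; have [i2|i2] := ltnP i 2.
  rewrite ifT; last lia.
  rewrite (u_left i) // mulrA -rec.
  have [i0|i1] : i = 0%N \/ i = 1%N by lia.
    by rewrite i0 /= S0 !addr0 u_left.
  rewrite i1 /= u2 u_left // mulrDl divff // gt_eqF // gt0 //; lia.
rewrite (u_right i); last lia.
have -> : (m - i = (m - i.+1).+1)%N by lia.
have i0 : (0 < i)%N by lia.
rewrite mulrA -rec mulrDl i0.
rewrite [LHS]addrC; congr (_ + _).
  by rewrite u_right; [congr (S _ / _); lia | lia].
case: ltnP => im1; first by rewrite u_right //; lia.
by have -> : (m - i.+1 = 0)%N by [lia]; rewrite S0 mul0r.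
Qed.

(** For S k = sin (k theta) and c = cos theta the factors are the Chebyshev
    polynomials of the second kind. *)
Lemma sin_multiples (S : nat -> R) (c : R) : S 0%N = 0 ->
  (forall k, S k.+2 + S k = 2 * c * S k.+1) ->
  [/\ S 2%N = 2 * c * S 1%N, S 3%N = (4 * c ^+ 2 - 1) * S 1%N,
      S 4%N = (8 * c ^+ 3 - 4 * c) * S 1%N
    & S 5%N = (16 * c ^+ 4 - 12 * c ^+ 2 + 1) * S 1%N].
Proof.
move=> S0 rec'; have rec k : S k.+2 = 2 * c * S k.+1 - S k by rewrite -rec' addrK.
have e2 : S 2%N = 2 * c * S 1%N by rewrite rec S0 subr0.
have e3 : S 3%N = (4 * c ^+ 2 - 1) * S 1%N by rewrite rec e2; ring.
have e4 : S 4%N = (8 * c ^+ 3 - 4 * c) * S 1%N by rewrite rec e3 e2; ring.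
by split=> //; rewrite rec e4 e3; ring.
Qed.

End Eigenvectors.

Section EigenvectorsE.
Variable R : realType.

Local Notation lam h := (2 * cos (pi / h%:R : R)).

Lemma cos_multiples (x : R) (c := cos x) :
  [/\ cos (2 * x) = 2 * c ^+ 2 - 1, cos (3 * x) = 4 * c ^+ 3 - 3 * c
    & cos (5 * x) = 16 * c ^+ 5 - 20 * c ^+ 3 + 5 * c].
Proof.
have rec k : cos (k.+2%:R * x) = 2 * c * cos (k.+1%:R * x) - cos (k%:R * x).
  have -> : k.+2%:R * x = k.+1%:R * x + x by rewrite [in LHS]mulrS; ring.
  have -> : k%:R * x = k.+1%:R * x - x by rewrite [in RHS]mulrS; ring.
  by rewrite cosD cosB /c; ring.
have c0 : cos (0%:R * x) = 1 by rewrite mul0r cos0.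
have c1 : cos (1%:R * x) = c by rewrite mul1r.
have c2 : cos (2%:R * x) = 2 * c ^+ 2 - 1 by rewrite rec c1 c0; ring.
have c3 : cos (3%:R * x) = 4 * c ^+ 3 - 3 * c by rewrite rec c2 c1; ring.
have c4 : cos (4%:R * x) = 8 * c ^+ 4 - 8 * c ^+ 2 + 1 by rewrite rec c3 c2; ring.
by split=> //; rewrite rec c4 c3; ring.
Qed.

Let sin_neq0 h k : (2 <= h)%N -> (0 < k < h)%N -> sin (k%:R * (pi / h%:R : R)) != 0.
Proof. by move=> h2 kh; rewrite gt_eqF // sin_mul_gt0. Qed.

(** For h = 12, 18 and 30 the angle pi / 6 is 2, 3 and 5 times theta = pi / h.
    Written in terms of cos theta, the relation 4 cos^2 (pi / 6) = 3 is the
    equation at the branching vertex up to nonzero factors. *)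
Lemma center_E6 (S := fun k => sin (k%:R * (pi / 12%:R)) : R) :
  S 1%N / S 2%N + S 2%N / S 3%N + S 2%N / S 3%N = lam 12.
Proof.
have [e2 e3 _ _] := @sin_multiples R S _ (sin_mul0 R 12) (sin_mul_rec R 12).
have n1 : S 1%N != 0 by exact: sin_neq0.
have n2 : S 2%N != 0 by exact: sin_neq0.
have n3 : S 3%N != 0 by exact: sin_neq0.
have := cos_pi6 R; have -> : pi / 6%:R = 2 * (pi / 12%:R) :> R by field.
have [-> _ _] := cos_multiples (pi / 12%:R).
move: e2 e3 n2 n3; set c := cos _ => -> -> n2 n3 rel.
have c0 : c != 0 by apply: contraNneq n2 => ->; rewrite !(mulr0, mul0r).
have x1 : 4 * c ^+ 2 - 1 != 0 by apply: contraNneq n3 => ->; rewrite mul0r.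
apply/eqP; rewrite -subr_eq0; apply/eqP.
transitivity ((3 - 4 * (2 * c ^+ 2 - 1) ^+ 2) / (2 * c * (4 * c ^+ 2 - 1))).
  by field; rewrite n1 c0 x1.
by rewrite rel subrr mul0r.
Qed.

Lemma center_E7 (S := fun k => sin (k%:R * (pi / 18%:R)) : R) :
  S 1%N / S 2%N + S 2%N / S 3%N + S 3%N / S 4%N = lam 18.
Proof.
have [e2 e3 e4 _] := @sin_multiples R S _ (sin_mul0 R 18) (sin_mul_rec R 18).
have n1 : S 1%N != 0 by exact: sin_neq0.
have n2 : S 2%N != 0 by exact: sin_neq0.
have n3 : S 3%N != 0 by exact: sin_neq0.
have n4 : S 4%N != 0 by exact: sin_neq0.
have := cos_pi6 R; have -> : pi / 6%:R = 3 * (pi / 18%:R) :> R by field.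
have [_ -> _] := cos_multiples (pi / 18%:R).
move: e2 e3 e4 n2 n3 n4; set c := cos _ => -> -> -> n2 n3 n4 rel.
have c0 : c != 0 by apply: contraNneq n2 => ->; rewrite !(mulr0, mul0r).
have x1 : 4 * c ^+ 2 - 1 != 0 by apply: contraNneq n3 => ->; rewrite mul0r.
have x2 : 8 * c ^+ 3 - 4 * c != 0 by apply: contraNneq n4 => ->; rewrite mul0r.
apply/eqP; rewrite -subr_eq0; apply/eqP.
transitivity ((3 - 4 * (4 * c ^+ 3 - 3 * c) ^+ 2)
   / ((8 * c ^+ 3 - 4 * c) * (4 * c ^+ 2 - 1))).
  by field; rewrite n1 c0 x1 x2.
by rewrite rel subrr mul0r.
Qed.

Lemma center_E8 (S := fun k => sin (k%:R * (pi / 30%:R)) : R) :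
  S 1%N / S 2%N + S 2%N / S 3%N + S 4%N / S 5%N = lam 30.
Proof.
have [e2 e3 e4 e5] := @sin_multiples R S _ (sin_mul0 R 30) (sin_mul_rec R 30).
have n1 : S 1%N != 0 by exact: sin_neq0.
have n2 : S 2%N != 0 by exact: sin_neq0.
have n3 : S 3%N != 0 by exact: sin_neq0.
have n5 : S 5%N != 0 by exact: sin_neq0.
have n6 : S 6%N != 0 by exact: sin_neq0.
have e6 : S 6%N + S 4%N = _ * S 5%N := sin_mul_rec R 30 4.
have := cos_pi6 R; have -> : pi / 6%:R = 5 * (pi / 30%:R) :> R by field.
have [_ _ ->] := cos_multiples (pi / 30%:R).
move: e2 e3 e4 e5 e6 n2 n3 n5; set c := cos _ => -> -> -> -> e6 n2 n3 n5 rel.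
have c0 : c != 0 by apply: contraNneq n2 => ->; rewrite !(mulr0, mul0r).
have x1 : 4 * c ^+ 2 - 1 != 0 by apply: contraNneq n3 => ->; rewrite mul0r.
have x5 : 16 * c ^+ 4 - 12 * c ^+ 2 + 1 != 0 by apply: contraNneq n5 => ->; rewrite mul0r.
have x3 : 4 * c ^+ 2 - 3 != 0.
  apply: contraNneq n6 => x3.
  have -> : S 6%N = (4 * c ^+ 2 - 3) * (2 * c * (4 * c ^+ 2 - 1) * S 1%N).
    by move/(canRL (addrK _)): e6 => ->; ring.
  by rewrite x3 mul0r.
apply/eqP; rewrite -subr_eq0; apply/eqP.
transitivity ((3 - 4 * (16 * c ^+ 5 - 20 * c ^+ 3 + 5 * c) ^+ 2)
   / ((4 * c ^+ 2 - 3) * (2 * c * (4 * c ^+ 2 - 1) * (16 * c ^+ 4 - 12 * c ^+ 2 + 1)))).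
  by field; rewrite n1 c0 x1 x3 x5.
by rewrite rel subrr mul0r.
Qed.

Lemma eigenvector_E6 : exists u, positive_eigenvector DynE6 (lam 12) u.
Proof. exact: (@eigenvector_E R 5 12 isT isT center_E6). Qed.

Lemma eigenvector_E7 : exists u, positive_eigenvector DynE7 (lam 18) u.
Proof. exact: (@eigenvector_E R 6 18 isT isT center_E7). Qed.

Lemma eigenvector_E8 : exists u, positive_eigenvector DynE8 (lam 30) u.
Proof. exact: (@eigenvector_E R 7 30 isT isT center_E8). Qed.

End EigenvectorsE.

(** * Coxeter numbers *)

Section CoxeterAction.
Variable t : dynkin.
Local Notation n := (dyn_rank t).
Implicit Types u w : nat -> int.

Definition vec u : 'cV[int]_n := \col_(l < n) u l.

(** The coordinates of the image of u under the i-th simple reflection. *)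
Definition refl_coord (i : nat) u (l : nat) : int :=
  u l - (l == i)%:R * (2 * u i - \sum_(j < n) (dyn_adj t i j)%:R * u j).

Definition coxeter_coord u : nat -> int := foldr refl_coord u (iota 0 n).

Lemma simple_refl_vec i u : simple_refl i *m vec u = vec (refl_coord i u).
Proof.
apply/colP => l; rewrite !mxE.
transitivity (\sum_(j < n) ((l == j)%:R * u j) - (l == i)%:R *
  (\sum_(j < n) ((i == j)%:R *+ 2) * u j - \sum_(j < n) (dyn_adj t i j)%:R * u j)).
  rewrite -sumrB mulr_sumr -sumrB; apply: eq_bigr => j _; rewrite !mxE.
  by rewrite -muln2 natrM mulr_natr; ring.
have pick (i' : 'I_n) : \sum_(j < n) (i' == j)%:R * u j = u i'.
  rewrite (bigD1 i') //= eqxx mul1r big1 ?addr0 // => j.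
  by rewrite eq_sym => /negbTE->; rewrite mul0r.
rewrite pick /refl_coord; congr (_ - _ * (_ - _)).
by under eq_bigr do rewrite -mulr_natl -mulrA; rewrite -mulr_sumr pick.
Qed.

Lemma coxeter_vec u : Coxeter_elt t *m vec u = vec (coxeter_coord u).
Proof.
rewrite /Coxeter_elt /coxeter_coord -val_enum_ord.
have -> : \prod_(i < n) simple_refl i = \prod_(i <- enum 'I_n) simple_refl i.
  by rewrite enumT [index_enum _]unlock.
elim: (enum 'I_n) => [|i s IH] /=; first by rewrite big_nil mul1mx.
by rewrite big_cons -[_ * _]/(_ *m _) -mulmxA IH simple_refl_vec.
Qed.

Lemma coxeter_exp_vec j u : Coxeter_elt t ^+ j *m vec u = vec (iter j coxeter_coord u).
Proof.
elim: j => [|j IH]; first by rewrite expr0 mul1mx.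
by rewrite exprS -[_ * _]/(_ *m _) -mulmxA IH coxeter_vec.
Qed.

(** To see that a lower power is not the identity, it is enough that it moves
    the first simple root. *)
Lemma coxeter_numberP h : (0 < h)%N ->
  (forall k l, (k < n)%N -> (l < n)%N ->
     iter h coxeter_coord (fun i => (i == k)%:R) l = (l == k)%:R) ->
  (forall j, (0 < j < h)%N -> exists2 l, (l < n)%N &
     iter j coxeter_coord (fun i => (i == 0%N)%:R) l != (l == 0%N)%:R) ->
  is_Coxeter_number t h.
Proof.
move=> h0 fixes moves; split=> // [|j jh].
  apply/matrixP => l k; have := coxeter_exp_vec h (fun i => (i == k)%:R).
  move=> /colP/(_ l); rewrite !mxE fixes ?ltn_ord // => <-.
  rewrite (bigD1 k) //= mxE eqxx mulr1 big1 ?addr0 // => i.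
  by rewrite -val_eqE mxE => /negbTE->; rewrite mulr0.
have [l ln] := moves j jh; apply: contra_neq_not => cj1.
by have := coxeter_exp_vec j (fun i => (i == 0%N)%:R); rewrite cj1 mul1mx
  => /colP/(_ (Ordinal ln)); rewrite !mxE => <-.
Qed.

End CoxeterAction.

(** In types A and D the simple roots are the vectors e_i - e_(i+1) for i < m,
    together with e_(m-1) + e_m in type D. In the coordinates Y with respect to
    e_0, ..., e_m the reflections in the former are transpositions, and the
    product of these is a cycle. *)
Section CyclicCoordinates.
Variables (t : dynkin) (Y : (nat -> int) -> nat -> int) (m : nat).
Hypothesis Y_swap : forall i u l, (i < m)%N -> (l <= m)%N ->
  Y (refl_coord t i u) l = Y u (if l == i then i.+1 else if l == i.+1 then i else l).

Lemma Y_cycle k u l : (k <= m)%N -> (l <= m)%N ->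
  Y (foldr (refl_coord t) u (iota 0 k)) l
    = Y u (if l == 0%N then k else if (l <= k)%N then l.-1 else l).
Proof.
elim: k u => [|k IH] u km lm.
  by congr (Y u _); case: eqP => [->//|]; case: leqP; lia.
rewrite -[k.+1]addn1 iotaD foldr_cat /= IH ?(ltnW km) // Y_swap //.
  by congr (Y u _); repeat case: ifP; lia.
by repeat case: ifP; lia.
Qed.

End CyclicCoordinates.

(** The Coxeter element is a cycle of length n + 1; its j-th power maps e_0 to
    e_j and so does not fix e_0 - e_1 for 0 < j < n + 1. *)
Lemma coxeter_number_A n (n1 : (1 <= n)%N) : is_Coxeter_number (DynA n1) n.+1.
Proof.
pose t := DynA n1.
pose Y (u : nat -> int) l : int := (if (l < n)%N then u l else 0)
  - (if (0 < l)%N then u l.-1 else 0).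
have Y_swap i u l : (i < n)%N -> (l <= n)%N ->
    Y (refl_coord t i u) l
      = Y u (if l == i then i.+1 else if l == i.+1 then i else l).
  move=> im lm; rewrite /Y /refl_coord /dyn_adj /= path_sum (ltnW im) andbT.
  have [->|li] := eqVneq l i.
    rewrite ?eqxx im /=; case: (posnP i) => [->|i0] /=.
      by rewrite !mul1r; case: ifP => _; ring.
    rewrite [i.-1 == i]ltn_eqF ?prednK // mul1r mul0r.
    by case: ifP => _; ring.
  have [->|li1] := eqVneq l i.+1.
    rewrite /= ?eqxx im ?gtn_eqF // mul1r mul0r.
    by case: ifP => _; case: ifP => _; ring.
  rewrite mul0r subr0 [l.-1 == i]negbTE ?mul0r ?subr0 //; last by lia.
have Y_cox u l : (l <= n)%N ->
    Y (coxeter_coord t u) l = Y u (if l == 0%N then n else l.-1).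
  move=> lm; rewrite (Y_cycle Y_swap) //=; congr (Y u _).
  by case: eqP => // _; rewrite lm.
have Y_iter j u l : (j <= n.+1)%N -> (l <= n)%N ->
    Y (iter j (coxeter_coord t) u) l
      = Y u (if (j <= l)%N then (l - j)%N else (l + n.+1 - j)%N).
  elim: j l => [|j IH] l jn ln /=; first by rewrite subn0.
  rewrite Y_cox // IH; [|lia|by case: ifP; lia].
  by congr (Y u _); repeat case: ifP; lia.
apply: coxeter_numberP => // [k l kn ln|j /andP[j0 jn]].
  pose u (i : nat) : int := (i == k)%:R; set w := iter _ _ _.
  change (w l = u l).
  have Yw l' : (l' <= n)%N -> Y w l' = Y u l'.
    by move=> ln'; rewrite Y_iter //; congr (Y u _); case: ifP; lia.
  rewrite /= in ln; elim: l ln => [|l IH] ln; have := Yw _ (ltnW ln); rewrite /Y ln /=.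
    by rewrite !subr0.
  by rewrite IH ?(ltnW ln) // => /addIr.
apply: contrapT => same; set w := iter _ _ _ in same.
pose u (i : nat) : int := (i == 0%N)%:R.
have wu l : (l < n)%N -> w l = u l.
  by move=> ln; apply/eqP; apply: contrapT => ne; apply: same; exists l => //; apply/negP.
have : Y w j = Y u 0%N by rewrite (Y_iter j u j) ?leqnn ?subnn //; lia.
have -> : Y w j = Y u j.
  by rewrite /Y; case: ifP => [/wu->|_]; rewrite j0 wu //; lia.
rewrite /Y /u n1 /= gtn_eqF // if_same sub0r subr0 j0.
by case: eqP.
Qed.

(** With n = m + 1, the reflection in e_(m-1) + e_m exchanges the last two
    coordinates and changes their signs. So the Coxeter element is a cycle of
    the first m coordinates in which one step changes the sign, together with a
    change of sign of the last coordinate. *)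
Lemma coxeter_number_D n (n4 : (4 <= n)%N) : is_Coxeter_number (DynD n4) (2 * n.-1).
Proof.
case: n n4 => // m m3; have {}m3' : (3 <= m)%N by [].
pose t := DynD m3.
pose Y (u : nat -> int) l : int := (if (l < m)%N then u l else 0)
  - (if (0 < l)%N then u l.-1 else 0) + (if (m.-1 <= l)%N then u m else 0).
have b_eq : (m.+1 - 3 = m.-2)%N by lia.
have reflE i u l : (i <= m)%N -> refl_coord t i u l = u l - (l == i)%:R * (2 * u i -
    (if i == m then u m.-2 else
     (if (i.+1 < m)%N then u i.+1 else 0) + (if (0 < i)%N then u i.-1 else 0)
       + (if i == m.-2 then u m else 0))).
  by move=> im; rewrite /refl_coord /dyn_adj /= b_eq branch_sum //; lia.
have refl_other i u l : l != i -> (i <= m)%N -> refl_coord t i u l = u l.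
  by move=> /negbTE li im; rewrite reflE // li mul0r subr0.
have Y_swap i u l : (i < m)%N -> (l <= m)%N ->
    Y (refl_coord t i u) l
      = Y u (if l == i then i.+1 else if l == i.+1 then i else l).
  move=> im lm; have mi : m != i by rewrite gtn_eqF.
  rewrite /Y (refl_other i u m mi (ltnW im)).
  have reflii : refl_coord t i u i = (if (i.+1 < m)%N then u i.+1 else 0)
      + (if (0 < i)%N then u i.-1 else 0) + (if i == m.-2 then u m else 0) - u i.
    by rewrite reflE ?(ltnW im) // eqxx (ltn_eqF im) mul1r; ring.
  have [->|li] := eqVneq l i.
    rewrite im /= reflii; case: (posnP i) => [i0|i0].
      by rewrite i0 /=; repeat case: ifP; lia.
    rewrite (refl_other i u i.-1 _ (ltnW im)); last lia.
    by repeat case: ifP; lia.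
  have [->|li1] := eqVneq l i.+1.
    rewrite /= reflii (refl_other i u i.+1 _ (ltnW im)); last lia.
    by repeat case: ifP; lia.
  rewrite (refl_other i u l li (ltnW im)); case: posnP => // l0.
  by rewrite (refl_other i u l.-1 _ (ltnW im)) //; lia.
have Y_last u l : (l <= m)%N -> Y (refl_coord t m u) l =
    if l == m.-1 then - Y u m else if l == m then - Y u m.-1 else Y u l.
  move=> lm; have reflmm : refl_coord t m u m = u m.-2 - u m.
    by rewrite reflE // eqxx mul1r; ring.
  have low k : (k < m)%N -> refl_coord t m u k = u k.
    by move=> km; rewrite refl_other //; lia.
  rewrite /Y reflmm; case: (l =P m.-1) => l1.
    rewrite l1 !low; try lia.
    by repeat case: ifP; lia.
  case: (l =P m) => l2.
    rewrite l2 ltnn low; last lia.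
    by repeat case: ifP; lia.
  rewrite !low; try lia.
  by repeat case: ifP; lia.
have Y_cox u l : (l <= m)%N -> Y (coxeter_coord t u) l =
    if l == 0%N then - Y u m.-1 else if l == m then - Y u m else Y u l.-1.
  move=> lm; rewrite /coxeter_coord -[dyn_rank t]addn1 iotaD foldr_cat.
  rewrite (Y_cycle Y_swap) //= add0n Y_last; last by repeat case: ifP; lia.
  case: (l =P 0%N) => [_|l0]; first by rewrite gtn_eqF ?eqxx //; lia.
  rewrite lm; have [->|l1] := eqVneq l m; first by rewrite eqxx.
  by rewrite ifF ?ifF //; lia.
have Y_half j u l : (j <= m)%N -> (l < m)%N -> Y (iter j (coxeter_coord t) u) l =
    if (j <= l)%N then Y u (l - j)%N else - Y u (l + m - j)%N.
  elim: j l => [|j IH] l jm lm; first by rewrite subn0.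
  rewrite iterS Y_cox; last lia.
  rewrite (ltn_eqF lm) !IH; try lia.
  case: (l =P 0%N) => [->|l0].
    have -> : (j <= m.-1)%N by lia.
    by congr (- Y u _); lia.
  have -> : (j <= l.-1)%N = (j < l)%N by lia.
  by case: ifP => _; [congr (Y u _) | congr (- Y u _)]; lia.
have Y_end j u : Y (iter j (coxeter_coord t) u) m = (-1) ^+ j * Y u m.
  elim: j => [|j IH]; first by rewrite expr0 mul1r.
  rewrite iterS Y_cox // eqxx IH exprS; case: eqP => [|_]; first lia.
  by rewrite mulN1r mulNr.
have Y_full j u l : (j <= m)%N -> (l < m)%N ->
    Y (iter (j + m) (coxeter_coord t) u) l =
    if (j <= l)%N then - Y u (l - j)%N else Y u (l + m - j)%N.
  move=> jm lm; have flip l' : (l' < m)%N -> Y (iter m (coxeter_coord t) u) l' = - Y u l'.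
    by move=> lm'; rewrite Y_half // leqNgt lm' /= addnK.
  by rewrite iterD Y_half //; case: ifP => jl; rewrite flip ?opprK //; lia.
apply: coxeter_numberP => [|k l kn ln|j /andP[j0 jn]]; first by rewrite /=; lia.
  pose u (i : nat) : int := (i == k)%:R; set w := iter _ _ _.
  change (w l = u l).
  have hm : (2 * m.+1.-1 = m + m)%N by rewrite /= mul2n addnn.
  have Yw l' : (l' < m)%N -> Y w l' = Y u l'.
    by move=> lm; rewrite /w hm Y_full // leqNgt lm /= addnK.
  have Ywm : Y w m = Y u m by rewrite /w hm Y_end -signr_odd oddD addbb expr0 mul1r.
  have low : forall i, (i < m.-1)%N -> w i = u i.
    elim=> [|i IH] im; have := Yw _ (leq_trans im (leq_pred m)); rewrite /Y.
      by rewrite ltnn; repeat case: ifP; lia.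
    by rewrite /= IH; [repeat case: ifP; lia | lia].
  have low2 : w m.-2 = u m.-2 by apply: low; lia.
  have Yw1 : Y w m.-1 = Y u m.-1 by apply: Yw; lia.
  move: Ywm Yw1; rewrite /Y /= low2; rewrite /= in ln.
  have [lm1|[lm1|lm1]] : (l < m.-1)%N \/ l = m.-1 \/ l = m by lia.
  - by move=> _ _; exact: low.
  - by rewrite lm1; repeat case: ifP; lia.
  - by rewrite lm1; repeat case: ifP; lia.
rewrite /= in jn; apply: contrapT => same; set w := iter _ _ _ in same.
pose u (i : nat) : int := (i == 0%N)%:R.
have wu l : (l <= m)%N -> w l = u l.
  by move=> ln; apply/eqP; apply: contrapT => ne; apply: same; exists l => //; apply/negP.
have Ywu l : (l <= m)%N -> Y w l = Y u l.
  by move=> lm; rewrite /Y; repeat case: ifP => ?; rewrite ?wu //; lia.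
have Yu0 : Y u 0%N = 1 by rewrite /Y /u /=; repeat case: ifP; lia.
have Yu l : (0 < l)%N -> (l < m)%N -> (Y u l <= 0).
  by move=> l0 lm; rewrite /Y /u; case: (l) l0 lm => // l' _ lm /=;
    repeat case: ifP; case: eqP; lia.
have [jm|mj] := ltnP j m.
  have := Y_half j u j (ltnW jm) jm; rewrite -/w Ywu ?(ltnW jm) // leqnn subnn Yu0.
  by have := Yu j j0 jm; lia.
have m_gt0 : (0 < m)%N by lia.
have [k jk] : exists k, j = (k + m)%N by exists (j - m)%N; lia.
have km : (k <= m)%N by lia.
have := Y_full k u 0%N km m_gt0; rewrite -jk -/w Ywu // Yu0 leqn0.
case: eqP => k0 //; rewrite add0n => Yk.
have k_pos : (0 < m - k)%N by lia.
have k_lt : (m - k < m)%N by lia.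
by have := Yu _ k_pos k_lt; rewrite -Yk.
Qed.

(** In type E the orbits of the simple roots are computed explicitly. *)
Section CoxeterComputation.
Variable t : dynkin.
Local Notation n := (dyn_rank t).

Definition refl_seq (i : nat) (s : seq int) : seq int :=
  mkseq (fun l => if l == i then
      foldr (fun j c => if dyn_adj t i j then nth 0 s j + c else c) 0 (iota 0 n) - nth 0 s i
    else nth 0 s l) n.

Definition coxeter_seq (s : seq int) : seq int := foldr refl_seq s (iota 0 n).

Definition root_seq (k : nat) : seq int := mkseq (fun i => (i == k)%:R) n.

Definition coxeter_check (h : nat) : bool :=
  [&& (0 < n)%N, all (fun k => iter h coxeter_seq (root_seq k) == root_seq k) (iota 0 n)
    & all (fun j => iter j coxeter_seq (root_seq 0) != root_seq 0) (iota 1 h.-1)].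

Lemma refl_coord_congr i u w l : (forall l, (l < n)%N -> u l = w l) -> (i < n)%N ->
  (l < n)%N -> refl_coord t i u l = refl_coord t i w l.
Proof.
move=> e im lm; rewrite /refl_coord !e //; congr (_ - _ * (_ - _)).
by apply: eq_bigr => j _; rewrite e.
Qed.

Lemma refl_seqE i s l : (i < n)%N -> (l < n)%N ->
  nth 0 (refl_seq i s) l = refl_coord t i (nth 0 s) l.
Proof.
move=> im lm; rewrite nth_mkseq // /refl_coord.
case: eqP => [->|_]; last by rewrite mul0r subr0.
rewrite mul1r -(big_mkord predT (fun j => (dyn_adj t i j)%:R * nth 0 s j)).
rewrite /index_iota subn0; set c := foldr _ _ _.
have -> : \sum_(j <- iota 0 n) (dyn_adj t i j)%:R * nth 0 s j = c.
  rewrite /c; elim: (iota 0 n) => [|j r IH]; first by rewrite big_nil.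
  by rewrite big_cons IH /=; case: ifP; rewrite ?mul1r ?mul0r ?add0r.
by ring.
Qed.

Lemma coxeter_seqE s l : (l < n)%N ->
  nth 0 (coxeter_seq s) l = coxeter_coord t (nth 0 s) l.
Proof.
rewrite /coxeter_seq /coxeter_coord.
have : all (fun i => (i < n)%N) (iota 0 n) by apply/allP => i; rewrite mem_iota.
elim: (iota 0 n) l => [|i r IH] //= l /andP[im rn] lm.
by rewrite refl_seqE //; apply: refl_coord_congr => // l' lm'; apply: IH.
Qed.

Lemma coxeter_coord_congr u w : (forall l, (l < n)%N -> u l = w l) ->
  forall l, (l < n)%N -> coxeter_coord t u l = coxeter_coord t w l.
Proof.
move=> e; rewrite /coxeter_coord.
have : all (fun i => (i < n)%N) (iota 0 n) by apply/allP => i; rewrite mem_iota.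
elim: (iota 0 n) => [|i r IH] /=; first by move=> _; exact: e.
by case/andP=> im rn l lm; apply: refl_coord_congr => // l' lm'; apply: IH.
Qed.

Lemma coxeter_iterE j k l : (l < n)%N -> nth 0 (iter j coxeter_seq (root_seq k)) l
  = iter j (coxeter_coord t) (fun i => (i == k)%:R) l.
Proof.
elim: j l => [|j IH] l lm; first by rewrite nth_mkseq.
by rewrite /= coxeter_seqE //; apply: coxeter_coord_congr.
Qed.

Lemma coxeter_checkP h : (0 < h)%N -> coxeter_check h -> is_Coxeter_number t h.
Proof.
move=> h0 /and3P[n0 /allP fixes /allP moves]; apply: coxeter_numberP => //.
  move=> k l kn ln; rewrite -coxeter_iterE //.
  by rewrite (eqP (fixes k _)) ?nth_mkseq ?mem_iota.
move=> j /andP[j0 jh]; apply: contrapT => same.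
have /negP[] : iter j coxeter_seq (root_seq 0) != root_seq 0.
  by apply: moves; rewrite mem_iota; lia.
have size_r i s : size (refl_seq i s) = n by rewrite size_mkseq.
have size_c s : size s = n -> size (coxeter_seq s) = n.
  by rewrite /coxeter_seq; elim: (iota 0 n) => //= i r IH /IH _.
have size_i i s : size s = n -> size (iter i coxeter_seq s) = n.
  by move=> sn; elim: i => //= i; exact: size_c.
apply/eqP/(@eq_from_nth _ 0); first by rewrite size_i ?size_mkseq.
rewrite size_i ?size_mkseq // => l ln; rewrite coxeter_iterE // nth_mkseq //.
by apply/eqP; apply: contrapT => ne; apply: same; exists l => //; apply/negP.
Qed.

End CoxeterComputation.

Lemma coxeter_number_E6 : is_Coxeter_number DynE6 12.
Proof. by apply: coxeter_checkP => //; vm_compute. Qed.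

Lemma coxeter_number_E7 : is_Coxeter_number DynE7 18.
Proof. by apply: coxeter_checkP => //; vm_compute. Qed.

Lemma coxeter_number_E8 : is_Coxeter_number DynE8 30.
Proof. by apply: coxeter_checkP => //; vm_compute. Qed.

Lemma dynkin_spectrum (R : realType) t : exists h, [/\ (2 <= h)%N, is_Coxeter_number t h
  & exists u, positive_eigenvector t (2 * cos (pi / h%:R) : R) u].
Proof.
case: t => [n n1|n n4|||].
- exists n.+1; split; [lia | exact: coxeter_number_A | exact: eigenvector_A].
- exists (2 * n.-1)%N; split; [lia | exact: coxeter_number_D | exact: eigenvector_D].
- exists 12%N; split; [lia | exact: coxeter_number_E6 | exact: eigenvector_E6].
- exists 18%N; split; [lia | exact: coxeter_number_E7 | exact: eigenvector_E7].
- exists 30%N; split; [lia | exact: coxeter_number_E8 | exact: eigenvector_E8].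
Qed.

Lemma coxeter_number_unique t h m :
  is_Coxeter_number t h -> is_Coxeter_number t m -> h = m.
Proof.
move=> [h0 h1 hmin] [m0 m1 mmin]; case: (ltngtP h m) => // hm.
  by case: (mmin h); rewrite ?h0.
by case: (hmin m); rewrite ?m0.
Qed.

(** * Quivers with a positive eigenvector *)

Section QuiverEigenvector.
Variables (R : realType) (Q : quiver).
Let a (x y : Q) : nat := (arrows x y + arrows y x)%N.
Variables (v : Q -> R) (d : R).
Hypothesis v_gt0 : forall x, 0 < v x.
Hypothesis v_eig : forall x, \sum_y (a x y)%:R * v y = d * v x.

(** Two positive vectors are not orthogonal, so as eigenvectors of a symmetric
    matrix they have the same eigenvalue. *)
Lemma dynkin_image_eigenvalue t (f : 'I_(dyn_rank t) -> Q) :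
  is_dynkin_image a f ->
  (forall i y, (0 < a (f i) y)%N -> exists j, f j = y) ->
  exists h, [/\ (2 <= h)%N, is_Coxeter_number t h & d = 2 * cos (pi / h%:R)].
Proof.
move=> [f_inj fa] f_closed; have [h [h2 th [u [u0 ue]]]] := dynkin_spectrum R t.
exists h; split=> //; set l := 2 * _ in ue *.
have rest (i : 'I_(dyn_rank t)) : \sum_(j < dyn_rank t) (dyn_adj t i j)%:R * v (f j) = d * v (f i).
  rewrite -v_eig [RHS](bigID (fun y => y \in [set f j | j in predT])) /=.
  rewrite [X in _ + X]big1 ?addr0 => [|y yf]; last first.
    case: (posnP (a (f i) y)) => [->|/f_closed[j fj]]; first by rewrite mul0r.
    by case/imsetP: yf; exists j.
  rewrite big_imset => [|j j' _ _]; last exact: f_inj.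
  by apply: eq_bigr => j _; rewrite fa.
have t0 : (0 < dyn_rank t)%N by case: (t) => // n /= /(leq_trans _)->.
have pair_gt0 : 0 < \sum_(i < dyn_rank t) u i * v (f i).
  rewrite (bigD1 (Ordinal t0)) //= ltr_wpDr // ?mulr_gt0 ?u0 //.
  by apply: sumr_ge0 => i _; rewrite mulr_ge0 // ltW // u0.
apply: (mulIf (lt0r_neq0 pair_gt0)); rewrite !mulr_sumr.
transitivity (\sum_(i < dyn_rank t) \sum_(j < dyn_rank t)
    u i * ((dyn_adj t i j)%:R * v (f j))).
  by apply: eq_bigr => i _; rewrite -mulr_sumr rest mulrCA.
rewrite exchange_big; apply: eq_bigr => j _ /=.
rewrite mulrA -ue // mulr_suml; apply: eq_bigr => i _.
by rewrite mulrA [u i * _]mulrC /dyn_adj orbC.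
Qed.

Lemma union_ADE_eigenvalue m : Q -> disjoint_union_ADE m Q ->
  (2 <= m)%N /\ d = 2 * cos (pi / m%:R).
Proof.
move=> x0 [J [D [t [tP [phi [[psi phiK psiK] phi_arr]]]]]].
pose j := tag (phi x0); have [[f [[g fK gK] fa]] tm] := tP j.
pose F i := psi (Tagged D (f i)).
have phiF i : phi (F i) = Tagged D (f i) by rewrite psiK.
have img : is_dynkin_image a F.
  split=> [i i' e|i i'].
    apply: (can_inj fK); have := phiF i; rewrite e phiF => /esym/eqP.
    by rewrite eq_Tagged => /eqP.
  rewrite -fa /a -(phi_arr (F i)) -(phi_arr (F i')) !phiF /= !eqxx.
  by rewrite !tagged_asE.
have closed i y : (0 < a (F i) y)%N -> exists i', F i' = y.
  rewrite /a -!phi_arr phiF; case e : (phi y) => [j' z].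
  have [jj'|ne] := eqVneq j' j; last first.
    by rewrite /= (negbTE ne) eq_sym (negbTE ne).
  move: z e; rewrite jj' => z e _; exists (g z).
  by apply: (can_inj phiK); rewrite phiF gK e.
have [h [h2 th dh]] := dynkin_image_eigenvalue img closed.
by rewrite (coxeter_number_unique tm th).
Qed.

Hypothesis no_loop : forall x : Q, arrows x x = 0%N.

Definition subquiver (P : pred Q) : quiver :=
  @Quiver {x : Q | P x} (fun u w => arrows (val u) (val w)).

Lemma cos_pi_div_inj h m : (2 <= h)%N -> (2 <= m)%N ->
  cos (pi / h%:R) = cos (pi / m%:R) :> R -> h = m.
Proof.
move=> h2 m2; have inn k : (2 <= k)%N -> pi / k%:R \in `[0, (pi : R)].
  move=> k2; have k0 : 0 < k%:R :> R by rewrite ltr0n; lia.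
  rewrite in_itv /=; apply/andP; split; first by rewrite divr_ge0 ?pi_ge0 ?ltW.
  by rewrite ler_pdivrMr // ler_peMr ?pi_ge0 // ler1n; lia.
move=> /(cos_inj (inn h h2) (inn m m2)) /(mulfI (lt0r_neq0 (pi_gt0 R))) /invr_inj.
by move/eqP; rewrite eqr_nat => /eqP.
Qed.

(** Each component is a Dynkin diagram, and the restriction of v to it fixes its
    Coxeter number. *)
Lemma eigenvalue_union_ADE m : (2 <= m)%N -> d = 2 * cos (pi / m%:R) -> d < 2 ->
  disjoint_union_ADE m Q.
Proof.
move=> m2 dm d2.
pose e := [rel x y : Q | (0 < a x y)%N].
have a_sym x y : a x y = a y x by rewrite /a addnC.
have a_irr x : a x x = 0%N by rewrite /a no_loop.
have e_sym : connect_sym e by apply: sym_connect_sym => x y; rewrite /= a_sym.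
(* the components are indexed by their canonical representatives *)
pose J : finType := {x : Q | roots e x}.
pose D (j : J) := subquiver (connect e (val j)).
have dynkinP (j : J) : exists t, ADE_quiver t (D j) /\ is_Coxeter_number t m.
  have [t [f [tf fP]]] := component_dynkin a_sym a_irr v_gt0 v_eig d2 (val j).
  exists t; split; last first.
    have [i y fy|h [h2 th dh]] := dynkin_image_eigenvalue tf.
      apply/fP; apply: connect_trans (connect1 fy); apply/fP.
      by exists i.
    have -> // : m = h; apply: cos_pi_div_inj => //.
    by apply: (@mulfI R 2); rewrite ?pnatr_eq0 // -dm -dh.
  have fc i : connect e (val j) (f i) by apply/fP; exists i.
  pose F i : D j := exist _ (f i) (fc i).
  have [g gP] := choice (fun y : D j => proj1 (fP (val y)) (valP y)).
  have [f_inj fa] := tf; exists F; split; last by move=> i i'; rewrite -fa.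
  exists g => [i|y]; first by apply: f_inj; rewrite gP.
  by apply: val_inj; rewrite /= gP.
have [t tP] := choice dynkinP; exists J, D, t; split=> //.
pose rt x : J := exist _ (fingraph.root e x) (roots_root e_sym x).
have rtP x : connect e (val (rt x)) x by rewrite e_sym /= connect_root.
pose phi (x : Q) : quiver_sum D := Tagged D (exist _ x (rtP x) : D (rt x)).
have sum_arrows (w w' : quiver_sum D) : arrows w w' =
    if tag w == tag w' then arrows (val (tagged w)) (val (tagged w')) else 0%N.
  case: w w' => [j y] [j' y'] /=; case: eqP => // jj'.
  by case: j' / jj' y' => y'; rewrite tagged_asE.
exists phi; split=> [|x y]; last first.
  rewrite sum_arrows /=; case: eqP => // ne.
  apply/esym/eqP; apply: contraT; rewrite -lt0n => xy; case: ne.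
  apply/val_inj => /=; apply/(fingraph.rootP e_sym)/connect1.
  by rewrite /= /a addn_gt0 xy.
have sum_ext (w w' : quiver_sum D) :
    tag w = tag w' -> val (tagged w) = val (tagged w') -> w = w'.
  case: w w' => [j y] [j' y'] /= jj'; case: j' / jj' y' => y' yy'.
  by congr (existT _ _ _); apply: val_inj.
exists (fun w : quiver_sum D => val (tagged w)) => [//|[j y]].
apply: sum_ext => //=; apply/val_inj; rewrite /= -[RHS](eqP (valP j)).
by apply/(fingraph.rootP e_sym); rewrite e_sym; exact: valP y.
Qed.

End QuiverEigenvector.

(** * Frobenius-Perron dimensions and the McKay quiver *)

Section FrobeniusPerron.
Variable R : realType.

(** Pairing |u| with p, for any left eigenvector u with eigenvalue x >= 0, gives
    x <= f. *)
Lemma FPeigenvalue_positive r (A : 'M[R]_r) (p : 'I_r -> R) (f : R) :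
  (0 < r)%N -> (forall i j, 0 <= A i j) -> (forall i, 0 < p i) ->
  (forall i, \sum_j A i j * p j = f * p i) -> FPeigenvalue A = f.
Proof.
case: r A p => // r A p _ A0 p0 pE.
have f0 : 0 <= f.
  rewrite -(pmulr_lge0 _ (p0 ord0)) -pE sumr_ge0 // => j _.
  by rewrite mulr_ge0 // ltW.
have f_eig : eigenvalue A f.
  rewrite /eigenvalue /eigenspace kermx_eq0 row_free_unit; apply/negP => unitA.
  have Ap : (A - f%:M) *m (\col_i p i) = 0.
    apply/colP => i; rewrite mulmxBl mul_scalar_mx !mxE.
    by under eq_bigr do rewrite mxE; rewrite pE subrr.
  have := congr1 (mulmx (invmx (A - f%:M))) Ap.
  rewrite mulKmx // mulmx0 => /colP/(_ ord0); rewrite !mxE => e.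
  by have := p0 ord0; rewrite e ltxx.
have f_max x : 0 <= x /\ eigenvalue A x -> x <= f.
  move=> [x0 /eigenvalueP[u uA nz]].
  have [j uj] : exists j, u ord0 j != 0.
    apply/existsP; apply: contraNT nz => /existsPn h.
    by apply/eqP/rowP => j; rewrite mxE; move/negPn/eqP: (h j).
  have up0 : 0 < \sum_i `|u ord0 i| * p i.
    rewrite (bigD1 j) //= ltr_wpDr ?mulr_gt0 ?normr_gt0 //.
    by apply: sumr_ge0 => i _; rewrite mulr_ge0 // ltW.
  rewrite -(ler_pM2r up0) !mulr_sumr.
  apply: (@le_trans _ _ (\sum_i (\sum_l `|u ord0 l| * A l i) * p i)).
    apply: ler_sum => i _; rewrite mulrA ler_pM2r //.
    rewrite -{1}(ger0_norm x0) -normrM.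
    have <- : (u *m A) ord0 i = x * u ord0 i by rewrite uA mxE.
    rewrite mxE; apply: le_trans (ler_norm_sum _ _ _) _.
    by apply: ler_sum => l _; rewrite normrM (ger0_norm (A0 _ _)).
  under eq_bigr do rewrite mulr_suml.
  rewrite exchange_big /=; apply: ler_sum => l _.
  under eq_bigr do rewrite -mulrA.
  by rewrite -mulr_sumr pE mulrCA.
rewrite /FPeigenvalue; set S := (X in sup X).
have Sf : S f by split.
have ubS : ubound S f by move=> x; exact: f_max.
apply/eqP; rewrite eq_le; apply/andP; split.
  by apply: ge_sup => //; exists f.
by apply: ub_le_sup => //; exists f.
Qed.

Section FusionCategory.
Variables (k : closedFieldType) (C : fusionCat k).
Variables (r : nat) (X : 'I_r -> C) (irrX : is_Irr X).
Local Notation T := (fusion_tensor C).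

Lemma irr_fusion_gt0 : (0 < r)%N.
Proof.
by case: irrX => _ _ /(_ _ (fusion_unit_simple C))[i _]; exact: leq_ltn_trans (ltn_ord i).
Qed.

(** Right multiplication by the sum of all the X i has positive entries and
    commutes with every left multiplication, so that its positive eigenvector
    is an eigenvector of all of these. *)
Lemma fusion_eigenvector : exists p : 'I_r -> R, (forall i, 0 < p i) /\
  forall P : C, exists f, forall l,
    \sum_j (dim_hom (tens T P (X j)) (X l))%:R * p j = f * p l.
Proof.
have := irr_fusion_gt0; case: r X irrX => // r' X' irrX' _.
pose N P l j := (dim_hom (tens T P (X' j)) (X' l)).
pose S l j := (\sum_i N (X' j) l i)%N.
have S0 l j : 0 < (S l j)%:R :> R.
  rewrite ltr0n; have [i Ni] := dim_tens_gt0 irrX' j l.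
  by rewrite /S (bigD1 i) //=; apply: ltn_addr.
have comm P l a : (\sum_j S l j * N P j a = \sum_b N P l b * S b a)%N.
  under eq_bigr do rewrite /S big_distrl /=.
  under [RHS]eq_bigr do rewrite /S big_distrr /=.
  rewrite exchange_big [RHS]exchange_big /=; apply: eq_bigr => i _.
  transitivity (dim_hom (tens T (tens T P (X' a)) (X' i)) (X' l)).
    by rewrite (dim_tensl irrX'); apply: eq_bigr => j _; rewrite mulnC.
  by rewrite dim_tensA (dim_tensr irrX'); apply: eq_bigr => b _; rewrite mulnC.
have [p [c [p0 pc]]] := perron_exists S0.
exists p; split=> // P.
pose w l := \sum_j (N P l j)%:R * p j.
suff [f wf] : exists f, forall l, w l = f * p l by exists f.
apply: (perron_unique S0 p0 pc) => l.
transitivity (\sum_a (\sum_j S l j * N P j a)%:R * p a).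
  under eq_bigr do rewrite mulr_sumr.
  rewrite exchange_big; apply: eq_bigr => a _; rewrite natr_sum mulr_suml.
  by apply: eq_bigr => j _; rewrite natrM mulrA.
under eq_bigr do rewrite comm natr_sum mulr_suml.
rewrite exchange_big mulr_sumr; apply: eq_bigr => b _ /=.
rewrite mulrCA -pc mulr_sumr.
by apply: eq_bigr => a _; rewrite natrM mulrA.
Qed.

(** If sum_i p_i [X i] is the common eigenvector in the Grothendieck ring, its
    action on the sum of all the L j is a positive vector with the same
    eigenvalues. Those of P and of its dual agree because the two matrices on
    the module category are transposes of each other. *)
Lemma module_eigenvector (M : fssModCat C) n (L : 'I_n -> M) (P : C) :
  is_Irr L -> exists v : 'I_n -> R, [/\ forall l, 0 < v l,
    forall l, \sum_j (dim_hom (mod_act M P (L j)) (L l))%:R * v j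
                = FPdim R X P * v l
    & forall l, \sum_j (dim_hom (mod_act M P (L l)) (L j))%:R * v j
                = FPdim R X P * v l].
Proof.
move=> irrL; have [p [p0 pP]] := fusion_eigenvector.
pose N Q l j := dim_hom (mod_act M Q (L j)) (L l).
pose v l := \sum_i \sum_j p i * (N (X i) l j)%:R.
have v0 l : 0 < v l.
  have [i iP] := dim_act_unit M irrX.
  rewrite /v (bigD1 i) //= ltr_wpDr //.
    by apply: sumr_ge0 => i' _; apply: sumr_ge0 => j _; rewrite mulr_ge0 // ltW.
  rewrite (bigD1 l) //= ltr_wpDr //.
    by apply: sumr_ge0 => j _; rewrite mulr_ge0 // ltW.
  rewrite mulr_gt0 // /N iP ltr0n.
  have [abM _ _ _] := mod_finite_abelian M.
  by rewrite (dim_hom_irr abM irrL) eqxx.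
have FP Q f : (forall l, \sum_j (dim_hom (tens T Q (X j)) (X l))%:R * p j = f * p l) ->
    FPdim R X Q = f.
  move=> Qf; apply: (FPeigenvalue_positive irr_fusion_gt0 _ p0) => [i j|i].
    by rewrite mxE.
  by rewrite -Qf; apply: eq_bigr => j _; rewrite mxE (gr_class_tensE irrX).
have vE Q l : \sum_j (N Q l j)%:R * v j = FPdim R X Q * v l.
  have [f Qf] := pP Q; rewrite (FP Q f Qf).
  transitivity (\sum_i \sum_j p i * (dim_hom (mod_act M (tens T Q (X i)) (L j)) (L l))%:R).
    under eq_bigr do rewrite mulr_sumr.
    rewrite exchange_big; apply: eq_bigr => i _ /=.
    under eq_bigr do rewrite mulr_sumr.
    rewrite exchange_big; apply: eq_bigr => j _ /=.
    rewrite -dim_actA (dim_act_mod irrL) natr_sum mulr_sumr.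
    by apply: eq_bigr => l' _; rewrite natrM /N; ring.
  transitivity (\sum_j \sum_a (\sum_i (dim_hom (tens T Q (X i)) (X a))%:R * p i)
      * (N (X a) l j)%:R).
    rewrite exchange_big; apply: eq_bigr => j _ /=.
    under [RHS]eq_bigr do rewrite mulr_suml.
    rewrite [RHS]exchange_big; apply: eq_bigr => i _ /=.
    rewrite (dim_act_cat irrX) natr_sum mulr_sumr.
    by apply: eq_bigr => a _; rewrite natrM /N; ring.
  rewrite exchange_big mulr_sumr; apply: eq_bigr => a _ /=.
  rewrite mulr_sumr; apply: eq_bigr => j _; rewrite Qf; ring.
exists v; split=> //; first exact: vE.
have [P' P'P] := dim_act_dual irrL P.
have transpose l : \sum_j (dim_hom (mod_act M P (L l)) (L j))%:R * v j
    = FPdim R X P' * v l.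
  by rewrite -vE; apply: eq_bigr => j _; rewrite /N P'P.
suff same : n = 0%N \/ FPdim R X P' = FPdim R X P.
  by case: same => [n0|e] l; [have := ltn_ord l; rewrite {2}n0 | rewrite transpose e].
have [->|n0] := posnP n; [by left | right].
have vv : 0 < \sum_l v l * v l.
  rewrite (bigD1 (Ordinal n0)) //= ltr_wpDr ?mulr_gt0 //.
  by apply: sumr_ge0 => l _; rewrite mulr_ge0 // ltW.
apply: (mulIf (lt0r_neq0 vv)); rewrite !mulr_sumr.
transitivity (\sum_l \sum_j v l * ((dim_hom (mod_act M P (L l)) (L j))%:R * v j)).
  by apply: eq_bigr => l _; rewrite -mulr_sumr transpose mulrCA.
rewrite exchange_big; apply: eq_bigr => j _ /=.
rewrite mulrA -vE mulr_suml; apply: eq_bigr => l _.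
by rewrite /N; ring.
Qed.

End FusionCategory.
End FrobeniusPerron.

Theorem corollary5p31 (R : realType) (k : closedFieldType) (C : fusionCat k)
    (M : fssModCat C) (Pi : C) (m : nat) (hm : (2 <= m)%N)
    (r : nat) (X : 'I_r -> C) (hX : is_Irr X)
    (n : nat) (L : 'I_n -> M) (hL : is_Irr L)
    (hM : exists V : M, ~ is_zero V) :
  disjoint_union_ADE m (separated (McKay_quiver L Pi)) <->
  FPdim R X Pi = 2 * cos (pi / m%:R) /\ 2 * cos (pi / m%:R) < 2 :> R.
Proof.
have [abM _ _ _] := mod_finite_abelian M.
have n0 : (0 < n)%N.
  have [V V0] := hM; have [[|q] [S [s [_ dS]]]] := irr_decomposition (@mod_semisimple _ _ M) hL V.
    case: V0; apply: is_zero_idm; case: dS => i [p [_ _ <-]].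
    by rewrite big_ord0.
  exact: leq_ltn_trans (ltn_ord (s ord0)).
have [v [v0 v_in v_out]] := module_eigenvector R hX Pi hL.
set d := FPdim R X Pi in v_in v_out *.
pose Q := separated (McKay_quiver L Pi).
pose w (x : Q) := v x.1.
have w0 x : 0 < w x by exact: v0.
have w_eig (x : Q) : \sum_y (arrows x y + arrows y x)%:R * w y = d * w x.
  case: x => l b; rewrite -(pair_bigA _ (fun j c =>
    (arrows ((l, b) : Q) (j, c) + arrows ((j, c) : Q) (l, b))%:R * v j)) /=.
  under eq_bigr do rewrite big_bool /=.
  case: b => /=; [rewrite -v_in | rewrite -v_out]; apply: eq_bigr => j _.
    by rewrite mul0r add0r.
  by rewrite addn0 mul0r addr0.
have no_loop (x : Q) : arrows x x = 0%N by case: x => l [].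
have cos_lt1 : cos (pi / m%:R) < 1 :> R.
  rewrite lt_neqAle cos_le1 andbT; apply/eqP => cos1.
  have m0 : 0 < m%:R :> R by rewrite ltr0n; lia.
  have in_m : pi / m%:R \in `[0, (pi : R)].
    rewrite in_itv /=; apply/andP; split; first by rewrite divr_ge0 ?pi_ge0 ?ltW.
    by rewrite ler_pdivrMr // ler_peMr ?pi_ge0 // ler1n; lia.
  have in_0 : 0 \in `[0, (pi : R)] by rewrite in_itv /= lexx pi_ge0.
  have /eqP := cos_inj in_m in_0 (etrans cos1 (esym (cos0 R))).
  by rewrite mulf_eq0 invr_eq0 !gt_eqF ?pi_gt0.
have lt2 : 2 * cos (pi / m%:R) < 2 :> R by rewrite gtr_pMr.
split=> [ADE|[dm _]].
  split=> //.
  exact: (union_ADE_eigenvalue w0 w_eig ((Ordinal n0, false) : Q) ADE).2.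
by apply: (eigenvalue_union_ADE w0 w_eig no_loop hm dm); rewrite dm.
Qed.
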